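(* If $\mathbb{K}$ is a field of characteristic zero, then $T_2(E_{0^*}\otimes E_0)=I$, i.e. every $\mathbb{Z}_2$-graded identity of $E_{0^*}\otimes E_0$ follows from the identities (1)–(7). If $\mathbb{K}$ is an infinite field of characteristic $p>2$, then $T_2(E_{0^*}\otimes E_0)=I_p$, i.e. every $\mathbb{Z}_2$-graded identity follows from (1)–(7) together with (8) and (9).
   Context: $E$ is the Grassmann algebra of a vector space with countable basis $e_1,e_2,\dots$ (generated by the $e_i$ with $e_ie_j=-e_je_i$), with canonical $\mathbb{Z}_2$-grading $E=E^{(0)}\oplus E^{(1)}$ (even/odd length monomials). $A=E\otimes E$ has the $\mathbb{Z}_2\times\mathbb{Z}_2$-grading $A_{(a,b)}=E^{(a)}\otimes E^{(b)}$. $E_{0^*}\otimes E_0$ denotes $A$ with the $\mathbb{Z}_2$-grading $A_0=A_{(0,0)}\oplus A_{(1,0)}$, $A_1=A_{(0,1)}\oplus A_{(1,1)}$. $\mathbb{K}\langle Y\cup Z\rangle$ is the free associative algebra on disjoint countable sets $Y=\{y_1,\dots\}$ (degree $0$) and $Z=\{z_1,\dots\}$ (degree $1$). $T_2(A)$ is the set of polynomials vanishing under every substitution of the $y_i$ by elements of $A_0$ and the $z_i$ by elements of $A_1$. A $T_2$-ideal is an ideal stable under all graded endomorphisms (sending $y_i$ to degree-$0$ and $z_i$ to degree-$1$ polynomials). Notation: $[a,b]=ab-ba$, $[a_1,\dots,a_n]=[[a_1,\dots,a_{n-1}],a_n]$, $a\circ b=ab+ba$. The identities are: (1) $[y_1,y_2,y_3]$,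 $[y_1,y_2,z_3]$; (2) $[y_1,z_2,y_3]$; (3) $[y_1,z_2]\circ z_3$; (4) $[z_1\circ z_2,z_3]$; (5) $(z_1\circ z_2)(z_3\circ z_4)-(z_1\circ z_3)(z_2\circ z_4)$; (6) $[x_1,y_2][y_3,x_4]+[x_1,y_3][y_2,x_4]$ for all choices $x_1\in\{y_1,z_1\}$, $x_4\in\{y_4,z_4\}$; (7) $[y_1,z_2](z_3\circ z_4)-[y_1,z_3](z_2\circ z_4)$; and, in characteristic $p$, (8) $[y_1,z_1]\cdots[y_{2k-2},z_1](z_2\circ z_1)z_1^{2n}$ and (9) $[y_1,z_1]\cdots[y_{2k-1},z_1]z_1^{2n}$, for all integers $k\ge1$, $n\ge0$ with $2n+2k-1=p$. $I$ is the $T_2$-ideal generated by (1)–(7) and $I_p$ the $T_2$-ideal generated by (1)–(9). *)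

(* Defs.v *)
From HB Require Import structures.
From mathcomp Require Import all_boot all_order all_algebra.
From Stdlib Require List.
Set Implicit Arguments. Unset Strict Implicit. Unset Printing Implicit Defensive.
Import Order.TTheory GRing.Theory Num.Theory.
Local Open Scope ring_scope.

Section GradedIdentities.
Variable K : fieldType.

(* A polynomial is represented by a finite list of monomials (c, w) with    *)
(* c : K and w a word in the variables, standing for the sum of the c*w.    *)
(* Two representatives denote the same element of K<Y u Z> iff they have   *)
(* the same coefficient function [pcoef].                                   *)
Definition var := (bool * nat)%type.
Definition yv (i : nat) : var := (false, i).
Definition zv (i : nat) : var := (true, i).
Definition vdeg (x : var) : bool := x.1.

Definition fpoly := seq (K * seq var).

Definition pcoef (f : fpoly) (w : seq var) : K :=
  \sum_(m <- f | m.2 == w) m.1.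

Definition pzero : fpoly := [::].
Definition pone : fpoly := [:: (1, [::])].
Definition pvar (x : var) : fpoly := [:: (1, [:: x])].
Definition padd (f g : fpoly) : fpoly := f ++ g.
Definition pscale (c : K) (f : fpoly) : fpoly := [seq (c * m.1, m.2) | m <- f].
Definition pneg (f : fpoly) : fpoly := pscale (-1) f.
Definition psub (f g : fpoly) : fpoly := padd f (pneg g).
Definition pmul (f g : fpoly) : fpoly :=
  [seq (m.1 * n.1, m.2 ++ n.2) | m <- f, n <- g].
Definition pprod (l : seq fpoly) : fpoly := foldr pmul pone l.
Definition psum (l : seq fpoly) : fpoly := foldr padd pzero l.
Definition ppow (f : fpoly) (n : nat) : fpoly := pprod (nseq n f).

Definition pcomm (f g : fpoly) : fpoly := psub (pmul f g) (pmul g f).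
Definition pcirc (f g : fpoly) : fpoly := padd (pmul f g) (pmul g f).

Definition wdeg (w : seq var) : bool := odd (count vdeg w).

Definition phomog (b : bool) (f : fpoly) : Prop :=
  forall w, pcoef f w != 0 -> wdeg w = b.

Definition psubst (sigma : var -> fpoly) (f : fpoly) : fpoly :=
  psum [seq pscale m.1 (pprod [seq sigma x | x <- m.2]) | m <- f].

Definition graded_endo (sigma : var -> fpoly) : Prop :=
  forall x, phomog (vdeg x) (sigma x).

Record gen_term := GenTerm {
  gt_left : fpoly; gt_gen : fpoly; gt_subst : var -> fpoly; gt_right : fpoly }.

Definition gen_term_val (t : gen_term) : fpoly :=
  pmul (pmul (gt_left t) (psubst (gt_subst t) (gt_gen t))) (gt_right t).

Definition T2ideal (G : fpoly -> Prop) (f : fpoly) : Prop :=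
  exists l : seq gen_term,
    (forall t, List.In t l -> G (gt_gen t) /\ graded_endo (gt_subst t)) /\
    (forall w, pcoef f w = pcoef (psum [seq gen_term_val t | t <- l]) w).

(* The algebra A = E (x) E.                                                 *)
(* A word u : seq nat in the generators e_i of the Grassmann algebra E      *)
(* equals 0 if a letter repeats, and (-1)^(inversions u) e_S otherwise,    *)
(* where S = sort u is the corresponding basis monomial e_{s1}...e_{sk},    *)
(* s1 < ... < sk.  Elements of A are represented by finite lists of        *)
(* (c, (u, v)) standing for sum c * (u (x) v); their coordinates on the   *)
(* basis e_S (x) e_T are given by [acoef].                                 *)
Fixpoint inversions (u : seq nat) : nat :=
  if u is a :: u' then (count (fun b => b < a)%N u' + inversions u')%N else 0%N.

Definition gsign (u : seq nat) : K :=
  if uniq u then (-1) ^+ inversions u else 0.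

Definition Aelt := seq (K * (seq nat * seq nat)).

Definition acoef (a : Aelt) (S T : seq nat) : K :=
  \sum_(m <- a | (sort leq m.2.1 == S) && (sort leq m.2.2 == T))
     m.1 * gsign m.2.1 * gsign m.2.2.

Definition Azero (a : Aelt) : Prop := forall S T, acoef a S T = 0.

Definition Aone : Aelt := [:: (1, ([::], [::]))].
Definition Aadd (a b : Aelt) : Aelt := a ++ b.
Definition Ascale (c : K) (a : Aelt) : Aelt := [seq (c * m.1, m.2) | m <- a].
(* (u (x) v)(u' (x) v') = (u u') (x) (v v')  (ordinary tensor product of algebras) *)
Definition Amul (a b : Aelt) : Aelt :=
  [seq (m.1 * n.1, (m.2.1 ++ n.2.1, m.2.2 ++ n.2.2)) | m <- a, n <- b].

(* Z_2-grading of E_{0*} (x) E_0: the degree is the parity of the second   *)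
(* tensor factor, A_0 = A_(0,0) + A_(1,0), A_1 = A_(0,1) + A_(1,1).        *)
Definition Ahomog (b : bool) (a : Aelt) : Prop :=
  forall S T, acoef a S T != 0 -> odd (size T) = b.

Definition Aeval (phi : var -> Aelt) (f : fpoly) : Aelt :=
  foldr Aadd [::]
    [seq Ascale m.1 (foldr Amul Aone [seq phi x | x <- m.2]) | m <- f].

Definition T2A (f : fpoly) : Prop :=
  forall phi : var -> Aelt, (forall x, Ahomog (vdeg x) (phi x)) ->
    Azero (Aeval phi f).

Definition y (i : nat) : fpoly := pvar (yv i).
Definition z (i : nat) : fpoly := pvar (zv i).
Definition pcomm3 a b c := pcomm (pcomm a b) c.

Definition gens17 : seq fpoly :=
  [:: (* (1) *) pcomm3 (y 1) (y 2) (y 3); pcomm3 (y 1) (y 2) (z 3);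
      (* (2) *) pcomm3 (y 1) (z 2) (y 3);
      (* (3) *) pcirc (pcomm (y 1) (z 2)) (z 3);
      (* (4) *) pcomm (pcirc (z 1) (z 2)) (z 3);
      (* (5) *) psub (pmul (pcirc (z 1) (z 2)) (pcirc (z 3) (z 4)))
                     (pmul (pcirc (z 1) (z 3)) (pcirc (z 2) (z 4)))] ++
  [seq padd (pmul (pcomm x1 (y 2)) (pcomm (y 3) x4))
            (pmul (pcomm x1 (y 3)) (pcomm (y 2) x4))
     | x1 <- [:: y 1; z 1], x4 <- [:: y 4; z 4]] ++
  [:: (* (7) *) psub (pmul (pcomm (y 1) (z 2)) (pcirc (z 3) (z 4)))
                     (pmul (pcomm (y 1) (z 3)) (pcirc (z 2) (z 4)))].

Definition id8 (k n : nat) : fpoly :=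
  pmul (pmul (pprod [seq pcomm (y i) (z 1) | i <- iota 1 (2 * k - 2)])
             (pcirc (z 2) (z 1)))
       (ppow (z 1) (2 * n)).

Definition id9 (k n : nat) : fpoly :=
  pmul (pprod [seq pcomm (y i) (z 1) | i <- iota 1 (2 * k - 1)])
       (ppow (z 1) (2 * n)).

Definition genI (f : fpoly) : Prop := List.In f gens17.

Definition genIp (p : nat) (f : fpoly) : Prop :=
  List.In f gens17 \/
  exists k n : nat, (1 <= k)%N /\ (2 * n + 2 * k - 1)%N = p /\
                    (f = id8 k n \/ f = id9 k n).

End GradedIdentities.

(* Main.v *)
Require Import Defs.
From HB Require Import structures.
From mathcomp Require Import all_boot all_order all_algebra.
From mathcomp Require Import boolp zify.
Set Implicit Arguments. Unset Strict Implicit. Unset Printing Implicit Defensive.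
Import GRing.Theory.
Local Open Scope ring_scope.

(** Write a homogeneous element of E (x) E as x = s + t with s in E^(0) (x) E and
    t in E^(1) (x) E.  Its supercommutator x x' - (-1)^(|x||x'|) x' x with another
    such element equals 2 t t', so that products of supercommutators of variables
    behave like products of "differentials" which commute for two odd variables
    and anticommute otherwise.  In the relatively free algebra, (1)-(7) say that
    supercommutators can be moved freely and their entries permuted with these
    signs; hence that algebra is spanned by the products of a sorted word w
    without repeated odd variable and of the supercommutators [u1,u2][u3,u4]...
    of a sorted word u without repeated even variable, where in characteristic p
    the cases k = 1 of (8) and (9) allow to assume that no odd variable occurs p
    times in u.  Over an infinite field an identity splits into multihomogeneous
    ones.  In a multihomogeneous combination of such products take a term with w
    of maximal length: there is a substitution in E (x) E under which this term
    survives and all the others vanish. *)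

(** * Quotients of monoid algebras *)

(** Maximality of w isolates a term because all terms have the same content: the longest w0 goes
    with a shortest u0. The substitution takes for t_x a sum of as many square-zero elements as x
    has occurrences in u0, so the product of the t's over a word u with at least |u0| letters
    vanishes unless u rearranges u0; sortedness then forces w = w0. What survives is a basis
    monomial of E (x) E times, up to sign, a power of 2 and the factorials of the multiplicities in
    u0. These factorials are nonzero exactly when the multiplicities stay below p, and the
    identities provide the matching bound: the supercommutator of an odd x with itself is 2 x^2, so
    p copies of x in u together with one more letter a produce a multiple of [a,x] x^(p-1), which is
    (8) or (9) with k = 1. On the spanning side the obstacle is that (5)-(7) exchange entries of two
    supercommutators only for some patterns of degrees. The missing pattern y, y, z, z is extracted
    from (3) at a product y z, and symmetries of the exchange relation do the rest. *)

Section MonoidAlgebraQuotient.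
Local Open Scope quotient_scope.
Variables (K : fieldType) (W : choiceType) (op : W -> W -> W) (e : W).
Implicit Types f g h : seq (K * W).

Definition lscale (c : K) f := [seq (c * m.1, m.2) | m <- f].
Definition lmul f g := [seq (m.1 * n.1, op m.2 n.2) | m <- f, n <- g].
Definition lcoef f (w : W) : K := \sum_(m <- f | m.2 == w) m.1.
Definition leval (V : lmodType K) (F : W -> V) f := \sum_(m <- f) m.1 *: F m.2.

Lemma leval_cat (V : lmodType K) (F : W -> V) f g :
  leval F (f ++ g) = leval F f + leval F g.
Proof. by rewrite /leval big_cat. Qed.

Lemma leval_scale (V : lmodType K) (F : W -> V) c f :
  leval F (lscale c f) = c *: leval F f.
Proof.
rewrite /leval big_map scaler_sumr; apply: eq_bigr => m _ /=.
by rewrite scalerA.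
Qed.

Lemma leval_mul (V : algType K) (F : W -> V) f g :
  (forall u v, F (op u v) = F u * F v) ->
  leval F (lmul f g) = leval F f * leval F g.
Proof.
move=> FM; rewrite /leval big_allpairs_dep /= mulr_suml; apply: eq_bigr => m _.
rewrite mulr_sumr; apply: eq_bigr => n _ /=.
by rewrite FM -scalerAl -scalerAr scalerA.
Qed.

Lemma leval_coef (V : lmodType K) (F : W -> V) f :
  leval F f = \sum_(w <- undup (map snd f)) lcoef f w *: F w.
Proof.
rewrite /leval; under [RHS]eq_bigr => w _ do rewrite /lcoef scaler_suml.
rewrite (exchange_big_dep xpredT) //=; apply: eq_big_seq => m mf.
rewrite big_mkcond (bigD1_seq m.2) ?undup_uniq ?mem_undup ?map_f //= eqxx.
by rewrite big1 ?addr0 // => w; rewrite eq_sym => /negPf->.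
Qed.

Lemma leval_coef0 (V : lmodType K) (F : W -> V) f :
  (forall w, lcoef f w = 0) -> leval F f = 0.
Proof. by move=> f0; rewrite leval_coef big1 // => w _; rewrite f0 scale0r. Qed.

Lemma lcoef_cat f g w : lcoef (f ++ g) w = lcoef f w + lcoef g w.
Proof. by rewrite /lcoef big_cat. Qed.

Lemma lcoef_scale c f w : lcoef (lscale c f) w = c * lcoef f w.
Proof. by rewrite /lcoef big_map -mulr_sumr. Qed.

Lemma leval_ext (V : lmodType K) (F : W -> V) f g :
  (forall w, lcoef f w = lcoef g w) -> leval F f = leval F g.
Proof.
move=> fg; apply/eqP; rewrite -subr_eq0 -scaleN1r -leval_scale -leval_cat.
apply/eqP/leval_coef0 => w.
by rewrite lcoef_cat lcoef_scale fg mulN1r subrr.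
Qed.

(** A two-sided ideal is given by a predicate on representatives that respects coefficients. Three
    instances follow: zero elements of E (x) E, zero polynomials, and a T_2-ideal. [null_proper]
    gives 1 != 0, which [nzRingType] demands. *)
Record monoid_ideal := MonoidIdeal {
  opA : associative op; op1m : left_id e op; opm1 : right_id e op;
  null : seq (K * W) -> Prop;
  null_ext : forall f g, (forall w, lcoef f w = lcoef g w) -> null f -> null g;
  null_nil : null [::];
  null_cat : forall f g, null f -> null g -> null (f ++ g);
  null_mull : forall f g, null f -> null (lmul g f);
  null_mulr : forall f g, null f -> null (lmul f g);
  null_proper : ~ null [:: (1, e)] }.

Variable J : monoid_ideal.
Let N := null J.

Lemma lcoef_mul f g w : lcoef (lmul f g) w =
  \sum_(m <- f) m.1 * \sum_(n <- g | op m.2 n.2 == w) n.1.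
Proof.
rewrite /lcoef big_mkcond big_allpairs_dep; apply: eq_bigr => m _ /=.
by rewrite mulr_sumr -big_mkcond.
Qed.

Lemma null_scale c f : N f -> N (lscale c f).
Proof.
move=> /(null_mull [:: (c, e)]); apply: null_ext => w.
rewrite lcoef_scale lcoef_mul big_seq1 /=; congr (_ * _).
by apply: eq_bigl => m; rewrite (op1m J).
Qed.

Definition lequiv f g : bool := `[< N (f ++ lscale (-1) g) >].

Lemma lequiv_ext f g : (forall w, lcoef f w = lcoef g w) -> lequiv f g.
Proof.
move=> fg; apply/asboolP; apply: null_ext (null_nil J) => w.
by rewrite lcoef_cat lcoef_scale fg mulN1r subrr /lcoef big_nil.
Qed.

Lemma lequiv_refl : reflexive lequiv.
Proof. by move=> f; apply: lequiv_ext. Qed.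

Lemma lequiv_trans : transitive lequiv.
Proof.
move=> g f h /asboolP fg /asboolP gh; apply/asboolP.
apply: null_ext (null_cat fg gh) => w.
by rewrite !(lcoef_cat, lcoef_scale) !mulN1r addrA subrK.
Qed.

Lemma lequiv_sym : symmetric lequiv.
Proof.
suff h f g : lequiv f g -> lequiv g f by move=> f g; apply/idP/idP; apply: h.
move=> /asboolP fg; apply/asboolP; apply: null_ext (null_scale (-1) fg) => w.
by rewrite !(lcoef_cat, lcoef_scale) !mulN1r opprD opprK addrC.
Qed.

Canonical lequiv_equiv := EquivRel lequiv lequiv_refl lequiv_sym lequiv_trans.

Definition mquot := {eq_quot lequiv}.
HB.instance Definition _ := Choice.on mquot.
HB.instance Definition _ : EqQuotient _ lequiv mquot := EqQuotient.on mquot.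

Definition cls f : mquot := \pi_mquot f.

Lemma cls_eq f g : cls f = cls g <-> N (f ++ lscale (-1) g).
Proof. by split=> [/eqmodP/asboolP|h]; last by apply/eqmodP/asboolP. Qed.

Lemma cls_ext f g : (forall w, lcoef f w = lcoef g w) -> cls f = cls g.
Proof. by move=> fg; apply/eqmodP/lequiv_ext. Qed.

Lemma cls_surj (q : mquot) : exists f, q = cls f.
Proof. by exists (repr q); rewrite /cls reprK. Qed.

Definition qadd (q r : mquot) : mquot := cls (repr q ++ repr r).
Definition qscale c (q : mquot) : mquot := cls (lscale c (repr q)).
Definition qmul (q r : mquot) : mquot := cls (lmul (repr q) (repr r)).

Lemma cls_repr f : N (repr (cls f) ++ lscale (-1) f).
Proof. by apply/cls_eq; rewrite /cls reprK. Qed.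

Lemma qaddE f g : qadd (cls f) (cls g) = cls (f ++ g).
Proof.
apply/cls_eq; apply: null_ext (null_cat (cls_repr f) (cls_repr g)) => w.
by rewrite !(lcoef_cat, lcoef_scale) !mulN1r opprD addrACA.
Qed.

Lemma qscaleE c f : qscale c (cls f) = cls (lscale c f).
Proof.
apply/cls_eq; apply: null_ext (null_scale c (cls_repr f)) => w.
by rewrite !(lcoef_cat, lcoef_scale) mulrDr mulrCA.
Qed.

(** Expansion along the right factor; with [lcoef_mul] it gives linearity in both arguments. *)
Lemma lcoef_mulC f g w : lcoef (lmul f g) w =
  \sum_(n <- g) (\sum_(m <- f | op m.2 n.2 == w) m.1) * n.1.
Proof.
rewrite lcoef_mul; under eq_bigr => m _ do rewrite big_mkcond mulr_sumr.
rewrite exchange_big; apply: eq_bigr => n _.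
rewrite mulr_suml [RHS]big_mkcond; apply: eq_bigr => m _.
by case: ifP => _; rewrite ?mulr0.
Qed.

Lemma lcoef_mulDl f1 f2 g w :
  lcoef (lmul (f1 ++ f2) g) w = lcoef (lmul f1 g) w + lcoef (lmul f2 g) w.
Proof. by rewrite !lcoef_mul big_cat. Qed.

Lemma lcoef_mulDr f g1 g2 w :
  lcoef (lmul f (g1 ++ g2)) w = lcoef (lmul f g1) w + lcoef (lmul f g2) w.
Proof. by rewrite !lcoef_mulC big_cat. Qed.

Lemma lcoef_mulZl c f g w : lcoef (lmul (lscale c f) g) w = c * lcoef (lmul f g) w.
Proof.
by rewrite !lcoef_mul big_map mulr_sumr; apply: eq_bigr => m _ /=; rewrite mulrA.
Qed.

Lemma lcoef_mulZr c f g w : lcoef (lmul f (lscale c g)) w = c * lcoef (lmul f g) w.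
Proof.
by rewrite !lcoef_mulC big_map mulr_sumr; apply: eq_bigr => m _ /=; rewrite mulrCA.
Qed.

Lemma qmulE f g : qmul (cls f) (cls g) = cls (lmul f g).
Proof.
apply/cls_eq; set f' := repr _; set g' := repr _.
(* f' g' - f g = (f' - f) g' + f (g' - g). *)
apply: null_ext (null_cat (null_mulr g' (cls_repr f)) (null_mull f (cls_repr g))) => w.
rewrite !(lcoef_cat, lcoef_mulDl, lcoef_mulDr, lcoef_mulZl, lcoef_mulZr).
by rewrite !lcoef_scale !mulN1r addrA subrK.
Qed.

Definition qE := (qaddE, qscaleE, qmulE).

Lemma qaddA : associative qadd.
Proof.
move=> a b c; have [[f ->] [g ->] [h ->]] := And3 (cls_surj a) (cls_surj b) (cls_surj c).
by rewrite !qE catA.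
Qed.

Lemma qaddC : commutative qadd.
Proof.
move=> a b; have [[f ->] [g ->]] := conj (cls_surj a) (cls_surj b).
by rewrite !qE; apply: cls_ext => w; rewrite !lcoef_cat addrC.
Qed.

Lemma qadd0 : left_id (cls [::]) qadd.
Proof. by move=> a; have [f ->] := cls_surj a; rewrite qE. Qed.

Lemma qaddN : left_inverse (cls [::]) (qscale (-1)) qadd.
Proof.
move=> a; have [f ->] := cls_surj a; rewrite !qE; apply: cls_ext => w.
by rewrite lcoef_cat lcoef_scale mulN1r addNr /lcoef big_nil.
Qed.

HB.instance Definition _ := GRing.isZmodule.Build mquot qaddA qaddC qadd0 qaddN.

Lemma qmulA : associative qmul.
Proof.
move=> a b c; have [[f ->] [g ->] [h ->]] := And3 (cls_surj a) (cls_surj b) (cls_surj c).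
rewrite !qE; congr cls; rewrite /lmul; elim: f => //= m f IH.
rewrite allpairs_cat IH; congr (_ ++ _); elim: g {IH} => //= n g IH.
rewrite map_cat IH; congr (_ ++ _); rewrite -map_comp; apply: eq_map => k /=.
by rewrite mulrA (opA J).
Qed.

Lemma qmul1 : left_id (cls [:: (1, e)]) qmul.
Proof.
move=> a; have [f ->] := cls_surj a; rewrite !qE; congr cls.
rewrite /lmul /= cats0 -[RHS]map_id; apply: eq_map => -[c w] /=.
by rewrite mul1r (op1m J).
Qed.

Lemma qmulr1 : right_id (cls [:: (1, e)]) qmul.
Proof.
move=> a; have [f ->] := cls_surj a; rewrite !qE; congr cls.
rewrite /lmul /=; elim: f => //= -[c w] f ->.
by rewrite mulr1 (opm1 J).
Qed.

Lemma qmulDl : left_distributive qmul +%R.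
Proof.
move=> a b c; have [[f ->] [g ->] [h ->]] := And3 (cls_surj a) (cls_surj b) (cls_surj c).
by rewrite /GRing.add /= !qE; apply: cls_ext => w; rewrite lcoef_cat lcoef_mulDl.
Qed.

Lemma qmulDr : right_distributive qmul +%R.
Proof.
move=> a b c; have [[f ->] [g ->] [h ->]] := And3 (cls_surj a) (cls_surj b) (cls_surj c).
by rewrite /GRing.add /= !qE; apply: cls_ext => w; rewrite lcoef_cat lcoef_mulDr.
Qed.

Lemma qone_neq0 : cls [:: (1, e)] != 0.
Proof.
apply/eqP => /cls_eq h; apply: (null_proper (m := J)).
by move: h; rewrite cats0.
Qed.

HB.instance Definition _ :=
  GRing.Zmodule_isNzRing.Build mquot qmulA qmul1 qmulr1 qmulDl qmulDr qone_neq0.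

Lemma qscaleA a b v : qscale a (qscale b v) = qscale (a * b) v.
Proof.
have [f ->] := cls_surj v; rewrite !qE; apply: cls_ext => w.
by rewrite !lcoef_scale mulrA.
Qed.

Lemma qscale1 : left_id 1 qscale.
Proof.
move=> v; have [f ->] := cls_surj v; rewrite !qE; apply: cls_ext => w.
by rewrite !lcoef_scale mul1r.
Qed.

Lemma qscaleDr : right_distributive qscale +%R.
Proof.
move=> c a b; have [[f ->] [g ->]] := conj (cls_surj a) (cls_surj b).
rewrite /GRing.add /= !qE; apply: cls_ext => w.
by rewrite !(lcoef_cat, lcoef_scale) mulrDr.
Qed.

Lemma qscaleDl v : {morph qscale^~ v : a b / a + b}.
Proof.
move=> a b; have [f ->] := cls_surj v; rewrite /GRing.add /= !qE.
by apply: cls_ext => w; rewrite !(lcoef_cat, lcoef_scale) mulrDl.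
Qed.

HB.instance Definition _ :=
  GRing.Zmodule_isLmodule.Build K mquot qscaleA qscale1 qscaleDr qscaleDl.

Lemma qscaleAl (c : K) (u v : mquot) : c *: (u * v) = (c *: u) * v.
Proof.
have [[f ->] [g ->]] := conj (cls_surj u) (cls_surj v).
rewrite /GRing.scale /GRing.mul /= !qE; apply: cls_ext => w.
by rewrite lcoef_scale lcoef_mulZl.
Qed.

HB.instance Definition _ := GRing.Lmodule_isLalgebra.Build K mquot qscaleAl.

Lemma qscaleAr (c : K) (u v : mquot) : c *: (u * v) = u * (c *: v).
Proof.
have [[f ->] [g ->]] := conj (cls_surj u) (cls_surj v).
rewrite /GRing.scale /GRing.mul /= !qE; apply: cls_ext => w.
by rewrite lcoef_scale lcoef_mulZr.
Qed.

HB.instance Definition _ := GRing.Lalgebra_isAlgebra.Build K mquot qscaleAr.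

Lemma clsD f g : cls (f ++ g) = cls f + cls g.
Proof. by rewrite /GRing.add /= qE. Qed.

Lemma clsM f g : cls (lmul f g) = cls f * cls g.
Proof. by rewrite /GRing.mul /= qE. Qed.

Lemma clsZ c f : cls (lscale c f) = c *: cls f.
Proof. by rewrite /GRing.scale /= qE. Qed.

Lemma cls_nil : cls [::] = 0. Proof. by []. Qed.

Lemma cls_eq0 f : cls f = 0 <-> N f.
Proof. by rewrite -cls_nil cls_eq cats0. Qed.

Lemma cls_leval f : cls f = leval (fun w => cls [:: (1, w)]) f.
Proof.
rewrite /leval; elim: f => [|[c w] f IH]; first by rewrite big_nil.
rewrite big_cons -IH -clsZ -clsD; congr cls => /=; by rewrite mulr1.
Qed.

End MonoidAlgebraQuotient.

(** * The algebra E (x) E *)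

Section GrassmannSquare.
Variable K : fieldType.

Definition cross (u v : seq nat) := (\sum_(a <- u) count (fun b => b < a)%N v)%N.

Lemma inversions_cat u v :
  inversions (u ++ v) = (inversions u + inversions v + cross u v)%N.
Proof.
rewrite /cross; elim: u => [|a u IH] /=; first by rewrite big_nil addn0.
by rewrite IH big_cons count_cat; lia.
Qed.

Lemma perm_cross u u' v v' :
  perm_eq u u' -> perm_eq v v' -> cross u v = cross u' v'.
Proof.
move=> uu' vv'; rewrite /cross (perm_big _ uu') /=.
by apply: eq_bigr => a _; apply/permP.
Qed.

(** As the letters are distinct, each pair is an inversion in exactly one of the two orders. This
    produces the sign (-1)^(|u||v|) of [gsign_swap]. *)
Lemma cross_sym u v : uniq (u ++ v) ->
  (cross u v + cross v u = size u * size v)%N.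
Proof.
have -> : cross v u = (\sum_(a <- u) count (fun b => a < b)%N v)%N.
  rewrite /cross; under eq_bigr => a _ do rewrite -sum1_count big_mkcond.
  rewrite exchange_big; apply: eq_bigr => b _.
  by rewrite -sum1_count [RHS]big_mkcond.
rewrite cat_uniq => /and3P[_ /hasPn vu _]; rewrite /cross -big_split /=.
rewrite (eq_big_seq (fun=> size v)) => [|a au].
  by rewrite big_const_seq count_predT iter_addn_0 mulnC.
rewrite -[RHS](count_predC (fun b => b < a)%N); congr addn.
apply: eq_in_count => b bv /=; rewrite -leqNgt [RHS]leq_eqVlt.
by case: eqP => // ab; have /negP[] := vu b bv; rewrite -ab.
Qed.

Local Notation gsign := (@gsign K).

Lemma inversions_sort u : inversions (sort leq u) = 0%N.
Proof.
have: sorted leq (sort leq u) by apply: sort_sorted; apply: leq_total.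
elim: (sort _ _) => //= a s IH; rewrite (path_sortedE leq_trans) => /andP[/allP h /IH->].
rewrite addn0; apply/eqP; rewrite -leqn0 leqNgt -has_count; apply/hasPn => b /h.
by rewrite leqNgt.
Qed.

Lemma perm_sort_leq (u : seq nat) : perm_eq u (sort leq u).
Proof. by rewrite perm_sym perm_sort. Qed.

(** Sorting [u] removes its own inversions and leaves those against [v] unchanged; a repeated letter
    makes both sides zero. *)
Lemma gsign_catl u v : gsign (u ++ v) = gsign u * gsign (sort leq u ++ v).
Proof.
rewrite /gsign !inversions_cat inversions_sort.
rewrite (perm_cross (perm_sort_leq u) (perm_refl v)).
rewrite (perm_uniq (perm_cat (perm_sort_leq u) (perm_refl v))).
case: ifP => [|_]; last by rewrite mulr0.
rewrite cat_uniq sort_uniq => /and3P[-> _ _].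
by rewrite -exprD add0n addnA.
Qed.

Lemma gsign_catr u v : gsign (v ++ u) = gsign u * gsign (v ++ sort leq u).
Proof.
rewrite /gsign !inversions_cat inversions_sort.
rewrite (perm_cross (perm_refl v) (perm_sort_leq u)).
rewrite (perm_uniq (perm_cat (perm_refl v) (perm_sort_leq u))).
case: ifP => [|_]; last by rewrite mulr0.
rewrite cat_uniq sort_uniq => /and3P[_ _ ->].
by rewrite -exprD addn0 addnA (addnC (inversions u)).
Qed.

Lemma gsign_swap u v : gsign (u ++ v) = (-1) ^+ (size u * size v) * gsign (v ++ u).
Proof.
rewrite /gsign [in RHS]uniq_catC; case: ifP => [uv|_]; last by rewrite mulr0.
rewrite !inversions_cat -(cross_sym uv) -exprD.
set n := (X in _ = _ ^+ X).
have -> : n = (inversions u + inversions v + cross u v + cross v u * 2)%N by lia.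
by rewrite [RHS]exprD [X in _ * X]exprM sqrr_sign mulr1.
Qed.

Definition W2 : choiceType := (seq nat * seq nat)%type.
Definition op2 (u v : W2) : W2 := (u.1 ++ v.1, u.2 ++ v.2).
Definition sort2 (u : W2) : W2 := (sort leq u.1, sort leq u.2).
Definition sign2 (u : W2) : K := gsign u.1 * gsign u.2.
Definition bcoef (S : W2) (u : W2) : K^o := if sort2 u == S then sign2 u else 0.

Lemma acoefE (a : Aelt K) S T : acoef a S T = leval (bcoef (S, T)) a.
Proof.
rewrite /acoef /leval big_mkcond; apply: eq_bigr => m _.
rewrite /bcoef xpair_eqE; case: ifP => _; rewrite ?scaler0 //.
by rewrite -mulrA.
Qed.

Lemma sort_catl (u v : seq nat) : sort leq (sort leq u ++ v) = sort leq (u ++ v).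
Proof.
apply/perm_sortP; [exact: leq_total|exact: leq_trans|exact: anti_leq|].
by apply: perm_cat (perm_refl v); rewrite perm_sort.
Qed.

Lemma sort_catr (u v : seq nat) : sort leq (v ++ sort leq u) = sort leq (v ++ u).
Proof.
apply/perm_sortP; [exact: leq_total|exact: leq_trans|exact: anti_leq|].
by apply: perm_cat (perm_refl v) _; rewrite perm_sort.
Qed.

Lemma bcoef_opl S u v : bcoef S (op2 u v) = sign2 u * bcoef S (op2 (sort2 u) v).
Proof.
rewrite /bcoef /sort2 /= !sort_catl; case: ifP => _; last by rewrite mulr0.
by rewrite /sign2 /= gsign_catl [gsign (u.2 ++ _)]gsign_catl mulrACA.
Qed.

Lemma bcoef_opr S u v : bcoef S (op2 v u) = sign2 u * bcoef S (op2 v (sort2 u)).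
Proof.
rewrite /bcoef /sort2 /= !sort_catr; case: ifP => _; last by rewrite mulr0.
by rewrite /sign2 /= gsign_catr [gsign (_ ++ u.2)]gsign_catr mulrACA.
Qed.

(** [a'] replaces each word by its signed basis monomial, so its coefficients are the coordinates of
    [a], and a functional of this shape depends on nothing else. By [bcoef_opl] and [bcoef_opr],
    coordinates of products have this shape, whence null elements form an ideal. *)
Lemma Azero_leval (a : Aelt K) (F : W2 -> K^o) : Azero a ->
  leval (fun u => sign2 u * F (sort2 u) : K^o) a = 0.
Proof.
move=> a0; pose a' := [seq (m.1 * sign2 m.2, sort2 m.2) | m <- a].
rewrite -[RHS](@leval_coef0 K _ _ F a') => [|[S T]].
  by rewrite /leval big_map; apply: eq_bigr => m _; apply: mulrA.
rewrite -[RHS](a0 S T) /lcoef big_map acoefE /leval big_mkcond.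
apply: eq_bigr => m _; rewrite /bcoef /=.
by case: ifP => _; rewrite ?scaler0.
Qed.

Lemma leval_mulV (V : lmodType K) (F : W2 -> V) (f g : seq (K * W2)) :
  leval F (lmul op2 f g) =
  \sum_(m <- f) \sum_(n <- g) m.1 *: (n.1 *: F (op2 m.2 n.2)).
Proof.
rewrite /leval big_allpairs_dep; apply: eq_bigr => m _; apply: eq_bigr => n _ /=.
by rewrite scalerA.
Qed.

Lemma Azero_ext (f g : Aelt K) :
  (forall w, @lcoef K W2 f w = lcoef g w) -> Azero f -> Azero g.
Proof.
by move=> fg f0 S T; rewrite acoefE -(leval_ext _ fg) -acoefE f0.
Qed.

Lemma Azero_mulr (f g : Aelt K) : Azero f -> Azero (lmul op2 f g).
Proof.
move=> f0 S T; rewrite acoefE leval_mulV exchange_big big1 // => n _.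
pose F u := bcoef (S, T) (op2 u n.2).
transitivity (n.1 *: leval (fun u => sign2 u * F (sort2 u) : K^o) f).
  rewrite /leval scaler_sumr; apply: eq_bigr => m _.
  by rewrite bcoef_opl !scalerA (mulrC m.1).
by rewrite Azero_leval ?scaler0.
Qed.

Lemma Azero_mull (f g : Aelt K) : Azero f -> Azero (lmul op2 g f).
Proof.
move=> f0 S T; rewrite acoefE leval_mulV big1 // => n _.
pose F u := bcoef (S, T) (op2 n.2 u).
transitivity (n.1 *: leval (fun u => sign2 u * F (sort2 u) : K^o) f).
  rewrite /leval scaler_sumr; apply: eq_bigr => m _.
  by rewrite bcoef_opr.
by rewrite Azero_leval ?scaler0.
Qed.

Lemma op2A : associative op2.
Proof. by move=> u v w; rewrite /op2 /= !catA. Qed.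

Lemma op20m : left_id (([::], [::]) : W2) op2.
Proof. by case. Qed.

Lemma op2m0 : right_id (([::], [::]) : W2) op2.
Proof. by case=> u v; rewrite /op2 /= !cats0. Qed.

Lemma Azero_nil : Azero ([::] : Aelt K).
Proof. by move=> S T; rewrite /acoef big_nil. Qed.

Lemma Azero_cat (f g : Aelt K) : Azero f -> Azero g -> Azero (f ++ g).
Proof. by move=> f0 g0 S T; rewrite /acoef big_cat /= -/(acoef f S T) f0 -/(acoef g S T) g0 addr0. Qed.

Lemma Azero_proper : ~ Azero [:: (1 : K, (([::], [::]) : W2))].
Proof.
move=> /(_ [::] [::]) /eqP; rewrite acoefE /leval big_seq1 /bcoef /sort2 /=.
by rewrite /sign2 /Defs.gsign /= scale1r expr0 mulr1 oner_eq0.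
Qed.

Definition JA := MonoidIdeal op2A op20m op2m0 Azero_ext Azero_nil Azero_cat
  Azero_mull Azero_mulr Azero_proper.

Definition QA : algType K := mquot JA.
Definition clsA (a : Aelt K) : QA := cls JA a.

End GrassmannSquare.

(** * Evaluation of polynomials and relatively free algebras *)

Section Evaluation.
Variable K : fieldType.
Implicit Types f g : fpoly K.

Definition WV : choiceType := seq var.

Section InAlgebra.
Variable V : algType K.
Implicit Type rho : var -> V.

Definition ev rho f : V := leval (fun w : WV => \prod_(x <- w) rho x) f.

Lemma ev_ext rho f g : (forall w, pcoef f w = pcoef g w) -> ev rho f = ev rho g.
Proof. by move=> fg; apply: leval_ext. Qed.

Lemma evD rho f g : ev rho (padd f g) = ev rho f + ev rho g.
Proof. exact: leval_cat. Qed.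

Lemma evZ rho c f : ev rho (pscale c f) = c *: ev rho f.
Proof. exact: leval_scale. Qed.

Lemma evB rho f g : ev rho (psub f g) = ev rho f - ev rho g.
Proof. by rewrite evD evZ scaleN1r. Qed.

Lemma evM rho f g : ev rho (pmul f g) = ev rho f * ev rho g.
Proof. by apply: leval_mul => u v; rewrite big_cat. Qed.

Lemma ev_nil rho : ev rho [::] = 0.
Proof. by rewrite /ev /leval big_nil. Qed.

Lemma ev1 rho : ev rho (pone K) = 1.
Proof. by rewrite /ev /leval big_seq1 big_nil scale1r. Qed.

Lemma ev_var rho x : ev rho (pvar K x) = rho x.
Proof. by rewrite /ev /leval big_seq1 big_seq1 scale1r. Qed.

Lemma ev_prod rho l : ev rho (pprod l) = \prod_(f <- l) ev rho f.
Proof. by elim: l => [|f l IH]; rewrite ?big_nil ?ev1 // big_cons -IH -evM. Qed.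

Lemma ev_sum rho l : ev rho (psum l) = \sum_(f <- l) ev rho f.
Proof. by elim: l => [|f l IH]; rewrite ?big_nil ?ev_nil // big_cons -IH -evD. Qed.

Lemma ev_pow rho f n : ev rho (ppow f n) = ev rho f ^+ n.
Proof. by rewrite ev_prod big_nseq iter_mulr_1. Qed.

Lemma ev_comm rho f g :
  ev rho (pcomm f g) = ev rho f * ev rho g - ev rho g * ev rho f.
Proof. by rewrite evB !evM. Qed.

Lemma ev_circ rho f g :
  ev rho (pcirc f g) = ev rho f * ev rho g + ev rho g * ev rho f.
Proof. by rewrite evD !evM. Qed.

Lemma ev_subst rho sigma f :
  ev rho (psubst sigma f) = ev (fun x => ev rho (sigma x)) f.
Proof.
rewrite ev_sum big_map; apply: eq_bigr => m _.
by rewrite evZ ev_prod big_map.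
Qed.

Definition evE := (evD, evZ, evB, evM, ev1, ev_var, ev_comm, ev_circ, ev_pow).

Lemma ev_T2ideal rho G f :
  (forall g sigma, G g -> graded_endo sigma -> ev (fun x => ev rho (sigma x)) g = 0) ->
  T2ideal G f -> ev rho f = 0.
Proof.
move=> GP [l [lG fl]]; rewrite (ev_ext rho fl) ev_sum big_map.
elim: l lG {fl} => [|t l IH] lG; first by rewrite big_nil.
rewrite big_cons IH ?addr0 => [|t' t'l]; last by apply: lG; right.
have [Gt St] : G (gt_gen t) /\ graded_endo (gt_subst t) by apply: lG; left.
by rewrite !evM ev_subst GP // mulr0 mul0r.
Qed.

End InAlgebra.

Lemma catA0 : associative (@cat var : WV -> WV -> WV). Proof. exact: catA. Qed.

Definition null0 f := forall w, pcoef f w = 0.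

Lemma null0_ext f g : (forall w, @lcoef K WV f w = lcoef g w) -> null0 f -> null0 g.
Proof. by move=> fg f0 w; exact: etrans (esym (fg w)) (f0 w). Qed.

Lemma null0_nil : null0 [::].
Proof. by move=> w; rewrite /pcoef big_nil. Qed.

Lemma null0_cat f g : null0 f -> null0 g -> null0 (f ++ g).
Proof.
move=> f0 g0 w; have -> : pcoef (f ++ g) w = pcoef f w + pcoef g w.
  exact: (@lcoef_cat K WV).
by rewrite f0 g0 addr0.
Qed.

Lemma pcoef_mul f g w : pcoef (pmul f g) w =
  \sum_(m <- f) m.1 * \sum_(n <- g | m.2 ++ n.2 == w) n.1.
Proof.
rewrite /pcoef big_mkcond big_allpairs_dep; apply: eq_bigr => m _ /=.
by rewrite mulr_sumr -big_mkcond.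
Qed.

Lemma null0_mulr f g : null0 f -> null0 (pmul f g).
Proof.
move=> f0 w; rewrite pcoef_mul.
exact: (@leval_coef0 K WV K^o (fun u => \sum_(n <- g | u ++ n.2 == w) n.1) f).
Qed.

Lemma null0_mull f g : null0 f -> null0 (pmul g f).
Proof.
move=> f0 w; rewrite pcoef_mul big1 // => m _.
have -> : \sum_(n <- f | m.2 ++ n.2 == w) n.1 =
   @leval K WV K^o (fun u => if m.2 ++ u == w then 1 else 0) f.
  rewrite big_mkcond; apply: eq_bigr => n _.
  by case: ifP => _; [rewrite -[RHS]/(_ * _) mulr1|rewrite scaler0].
by rewrite leval_coef0 ?mulr0.
Qed.

Lemma null0_proper : ~ null0 (pone K).
Proof.
by move/(_ [::])/eqP; rewrite /pcoef big_mkcond big_seq1 /= oner_eq0.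
Qed.

Definition J0 := MonoidIdeal catA0 (@cat0s var : left_id [::] (@cat var : WV -> WV -> WV))
  (@cats0 var) null0_ext null0_nil null0_cat null0_mull null0_mulr null0_proper.
Definition Q0 : algType K := mquot J0.
Definition X0 (x : var) : Q0 := cls J0 (pvar K x).

Lemma cls_ev (J : monoid_ideal K (@cat var : WV -> WV -> WV) [::]) f :
  cls J f = ev (fun x => cls J (pvar K x) : mquot J) f.
Proof.
rewrite cls_leval /ev /leval; apply: eq_bigr => m _; congr (_ *: _).
elim: (m.2) => [|x w IH]; first by rewrite big_nil.
by rewrite big_cons -IH -clsM; congr cls; rewrite /lmul /= mulr1.
Qed.

(** Equality of polynomials becomes an equation in the ring [Q0], so closure properties of
    T_2-ideals can be proved by ring rewriting. *)
Lemma ev_X0_inj f g : ev X0 f = ev X0 g <-> forall w, pcoef f w = pcoef g w.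
Proof.
split=> [|fg]; last exact: ev_ext.
rewrite -!cls_ev => /cls_eq fg w; have := fg w.
rewrite -[pcoef _ w]/(@lcoef K WV _ w) lcoef_cat lcoef_scale mulN1r => /eqP.
by rewrite subr_eq0 => /eqP.
Qed.

Section Ideal.
Variable G : fpoly K -> Prop.

Let tv (t : gen_term K) :=
  ev X0 (gt_left t) * ev X0 (psubst (gt_subst t) (gt_gen t)) * ev X0 (gt_right t).

Lemma T2idealP f : T2ideal G f <-> exists l : seq (gen_term K),
  (forall t, List.In t l -> G (gt_gen t) /\ graded_endo (gt_subst t)) /\
  ev X0 f = \sum_(t <- l) tv t.
Proof.
split=> -[l [lG fl]]; exists l; split=> //.
  rewrite (ev_ext X0 fl) ev_sum big_map; apply: eq_bigr => t _.
  by rewrite !evM.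
apply/ev_X0_inj; rewrite fl ev_sum big_map; apply: eq_bigr => t _.
by rewrite !evM.
Qed.

Lemma T2ideal_ext f g : (forall w, pcoef f w = pcoef g w) -> T2ideal G f -> T2ideal G g.
Proof. by move=> fg [l [lG fl]]; exists l; split=> // w; rewrite -fg. Qed.

Lemma T2ideal_nil : T2ideal G [::].
Proof. by apply/T2idealP; exists [::]; split=> //; rewrite big_nil ev_nil. Qed.

Lemma T2ideal_cat f g : T2ideal G f -> T2ideal G g -> T2ideal G (f ++ g).
Proof.
move=> /T2idealP[l [lG fl]] /T2idealP[l' [lG' fl']]; apply/T2idealP.
exists (l ++ l'); split=> [t|]; last first.
  by rewrite -[f ++ g]/(padd f g) evD fl fl' big_cat.
by rewrite List.in_app_iff => -[/lG|/lG'].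
Qed.

Lemma T2ideal_mull f g : T2ideal G f -> T2ideal G (pmul g f).
Proof.
move=> /T2idealP[l [lG fl]]; apply/T2idealP.
exists [seq GenTerm (pmul g (gt_left t)) (gt_gen t) (gt_subst t) (gt_right t) | t <- l].
split=> [t|].
  by rewrite List.in_map_iff => -[t' [<- /lG]].
rewrite evM fl big_map mulr_sumr; apply: eq_bigr => t _.
by rewrite /tv /= evM !mulrA.
Qed.

Lemma T2ideal_mulr f g : T2ideal G f -> T2ideal G (pmul f g).
Proof.
move=> /T2idealP[l [lG fl]]; apply/T2idealP.
exists [seq GenTerm (gt_left t) (gt_gen t) (gt_subst t) (pmul (gt_right t) g) | t <- l].
split=> [t|].
  by rewrite List.in_map_iff => -[t' [<- /lG]].
rewrite evM fl big_map mulr_suml; apply: eq_bigr => t _.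
by rewrite /tv /= evM !mulrA.
Qed.

Hypothesis G1 : ~ T2ideal G (pone K).

Definition JG := MonoidIdeal catA0 (@cat0s var : left_id [::] (@cat var : WV -> WV -> WV))
  (@cats0 var) T2ideal_ext T2ideal_nil T2ideal_cat T2ideal_mull T2ideal_mulr G1.
Definition QG : algType K := mquot JG.
Definition XG (x : var) : QG := cls JG (pvar K x).

Lemma ev_XG_eq0 f : ev XG f = 0 <-> T2ideal G f.
Proof. by rewrite -cls_ev; apply: cls_eq0. Qed.

Lemma T2ideal_gen g sigma : G g -> graded_endo sigma -> T2ideal G (psubst sigma g).
Proof.
move=> Gg Gs; apply/T2idealP.
exists [:: GenTerm (pone K) g sigma (pone K)]; split=> [t [<-|[]]//|].
by rewrite big_seq1 /tv /= !ev1 mul1r mulr1.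
Qed.

(** Chosen homogeneous representatives of the values of [rho] form a graded endomorphism, so
    generators vanish at all homogeneous elements of the relatively free algebra, not only at the
    variables. *)
Lemma ev_gen g (rho : var -> QG) : G g ->
  (forall x, exists f, phomog (vdeg x) f /\ rho x = ev XG f) -> ev rho g = 0.
Proof.
move=> Gg rhoP; have [sigma sigmaP] := choice rhoP.
have -> : rho = fun x => ev XG (sigma x) by apply/funext => x; case: (sigmaP x).
rewrite -ev_subst; apply/ev_XG_eq0/T2ideal_gen => // x.
by case: (sigmaP x).
Qed.

End Ideal.
End Evaluation.

(** * The identities hold in E (x) E *)

Section Soundness.
Variable K : fieldType.
Local Notation QA := (QA K).
Local Notation clsA := (@clsA K).
Implicit Types p q r : QA.

Definition ksign (b : bool) : K := (-1) ^+ b.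
Local Notation sg := ksign.

Lemma ksign_addb a b : sg (a (+) b) = sg a * sg b.
Proof. exact: signr_addb. Qed.

Lemma clsAD f g : clsA (f ++ g) = clsA f + clsA g. Proof. exact: clsD. Qed.
Lemma clsAZ c f : clsA (Ascale c f) = c *: clsA f. Proof. exact: clsZ. Qed.
Lemma clsAM f g : clsA (Amul f g) = clsA f * clsA g. Proof. exact: clsM. Qed.
Lemma clsA_nil : clsA [::] = 0. Proof. by []. Qed.
Lemma clsA_eq0 f : clsA f = 0 <-> Azero f. Proof. exact: cls_eq0. Qed.
Lemma clsA_cons m f : clsA (m :: f) = clsA [:: m] + clsA f.
Proof. by rewrite -clsAD. Qed.
Lemma clsA_coef c u : clsA [:: (c, u)] = c *: clsA [:: (1, u)].
Proof. by rewrite -clsAZ /Ascale /= mulr1. Qed.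

Definition wcolor (a b : bool) (m : K * (seq nat * seq nat)) :=
  (odd (size m.2.1) == a) && (odd (size m.2.2) == b).

Definition color (a b : bool) q := exists2 f, q = clsA f & all (wcolor a b) f.

Lemma color0 a b : color a b 0.
Proof. by exists [::]. Qed.

Lemma color1 : color false false 1.
Proof. by exists (Aone K). Qed.

Lemma colorD a b p q : color a b p -> color a b q -> color a b (p + q).
Proof.
move=> [f -> fab] [g -> gab]; exists (f ++ g); first by rewrite clsAD.
by rewrite all_cat fab.
Qed.

Lemma colorZ a b c q : color a b q -> color a b (c *: q).
Proof.
move=> [f -> fab]; exists (Ascale c f); first by rewrite clsAZ.
by rewrite all_map; apply: sub_all fab.
Qed.

Lemma colorM a b a' b' p q :
  color a b p -> color a' b' q -> color (a (+) a') (b (+) b') (p * q).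
Proof.
move=> [f -> /allP fab] [g -> /allP gab]; exists (Amul f g); first by rewrite clsAM.
apply/allP => _ /allpairsP[[m n] [/fab/andP[/eqP ma /eqP mb] /gab/andP[/eqP na /eqP nb] ->]].
by rewrite /wcolor /= !size_cat !oddD ma mb na nb !eqxx.
Qed.

Lemma clsA_word u v u' v' :
  clsA [:: (1, (u ++ u', v ++ v'))] =
  sg (odd (size u) && odd (size u') (+) odd (size v) && odd (size v')) *:
  clsA [:: (1, (u' ++ u, v' ++ v))].
Proof.
apply/eqP; rewrite -subr_eq0 -scaleN1r -!clsAZ -clsAD; apply/eqP/clsA_eq0 => S T.
rewrite /acoef /= big_mkcond big_cons big_seq1 /=.
have E (s t : seq nat) : sort leq (s ++ t) = sort leq (t ++ s).
  apply/perm_sortP; [exact: leq_total|exact: leq_trans|exact: anti_leq|].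
  by rewrite perm_catC.
rewrite (E u u') (E v v'); case: ifP => _; last by rewrite addr0.
rewrite (gsign_swap _ u) (gsign_swap _ v) ksign_addb /ksign -!oddM !signr_odd.
by rewrite mul1r mulr1 mulrACA mulN1r !mulNr !mulrA subrr.
Qed.

(** Each tensor factor contributes its own sign and none arises between the factors, the tensor
    product being the ordinary one. *)
Lemma color_comm a b a' b' p q : color a b p -> color a' b' q ->
  p * q = sg (a && a' (+) b && b') *: (q * p).
Proof.
move=> [f -> fab] [g -> gab].
elim: f fab => [|[c [u v]] f IH] /=; first by rewrite clsA_nil mul0r mulr0 scaler0.
move=> /andP[/andP[/eqP /= ua /eqP /= vb] /IH {}IH].
rewrite clsA_cons mulrDl mulrDr scalerDr IH; congr (_ + _).
elim: g gab {IH} => [|[d [u' v']] g IH] /=.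
  by rewrite clsA_nil mul0r mulr0 scaler0.
move=> /andP[/andP[/eqP /= ua' /eqP /= vb'] /IH {}IH].
rewrite [clsA (_ :: g)]clsA_cons mulrDl mulrDr scalerDr IH; congr (_ + _).
rewrite -!clsAM /Amul /= clsA_coef [in RHS]clsA_coef clsA_word ua vb ua' vb'.
by rewrite !scalerA mulrC (mulrC d).
Qed.

Lemma odd_word_sq0 u v (c : K) : odd (size u) -> clsA [:: (c, (u, v))] ^+ 2 = 0.
Proof.
move=> ou; rewrite expr2 -clsAM; apply/clsA_eq0 => S T.
rewrite /Amul /acoef /= big_mkcond big_seq1 /=; case: ifP => // _.
suff -> : gsign K (u ++ u) = 0 by rewrite mulr0 mul0r.
rewrite /gsign; case: u ou => // x u _; case: ifP => //.
by rewrite /= mem_cat inE eqxx orbT.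
Qed.

(** Elements of E^(1) (x) E^(1) commute with each other, so Frobenius is additive on them, and each
    word has square zero. This is the source of (8) and (9). *)
Lemma color11_pchar n q : n \in [pchar K] -> color true true q -> q ^+ n = 0.
Proof.
move=> nK [f -> fab].
have nQ : n \in [pchar QA] by rewrite pchar_lalg.
have n_gt1 : (1 < n)%N by apply: prime_gt1; case/andP: nK.
elim: f fab => [|[c [u v]] f IH] /=.
  by move=> _; rewrite clsA_nil expr0n; case: n n_gt1 {nK nQ}.
move=> /andP[/andP[/eqP /= ua /eqP /= vb] fab].
have h1 : color true true (clsA [:: (c, (u, v))]).
  by exists [:: (c, (u, v))]; rewrite //= /wcolor /= ua vb eqxx.
have h2 : color true true (clsA f) by exists f.
rewrite clsA_cons -(pFrobenius_autE nQ) pFrobenius_autD_comm; last first.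
  by rewrite /GRing.comm (color_comm h1 h2) scale1r.
rewrite !pFrobenius_autE IH // addr0.
by rewrite -(subnK n_gt1) exprD odd_word_sq0 ?ua ?mulr0.
Qed.

Definition homA (b : bool) q :=
  exists s t, [/\ color false b s, color true b t & q = s + t].

Lemma homA0 b : homA b 0.
Proof. by exists 0, 0; rewrite addr0; split=> //; apply: color0. Qed.

Lemma homA1 : homA false 1.
Proof. by exists 1, 0; rewrite addr0; split=> //; [apply: color1|apply: color0]. Qed.

Lemma homAD b p q : homA b p -> homA b q -> homA b (p + q).
Proof.
move=> [s [t [hs ht ->]]] [s' [t' [hs' ht' ->]]]; exists (s + s'), (t + t').
by rewrite addrACA; split=> //; apply: colorD.
Qed.

Lemma homAZ b c q : homA b q -> homA b (c *: q).
Proof.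
move=> [s [t [hs ht ->]]]; exists (c *: s), (c *: t).
by rewrite scalerDr; split=> //; apply: colorZ.
Qed.

Lemma homAM b b' p q : homA b p -> homA b' q -> homA (b (+) b') (p * q).
Proof.
move=> [s [t [hs ht ->]]] [s' [t' [hs' ht' ->]]].
exists (s * s' + t * t'), (s * t' + t * s'); split.
- by apply: colorD; [apply: (colorM hs hs')|apply: (colorM ht ht')].
- by apply: colorD; [apply: (colorM hs ht')|apply: (colorM ht hs')].
- by rewrite mulrDl !mulrDr (addrC (t * s')) addrACA.
Qed.

Lemma homA_prod (rho : var -> QA) w :
  (forall x, homA (vdeg x) (rho x)) -> homA (wdeg w) (\prod_(x <- w) rho x).
Proof.
move=> rhoP; elim: w => [|x w IH]; first by rewrite big_nil; apply: homA1.
rewrite big_cons /wdeg /= oddD oddb; exact: homAM.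
Qed.

Lemma homA_ev (rho : var -> QA) b f :
  (forall x, homA (vdeg x) (rho x)) -> phomog b f -> homA b (ev rho f).
Proof.
move=> rhoP fb; rewrite /ev leval_coef.
apply: (big_ind (homA b)) => [|p q|w _]; [exact: homA0|exact: homAD|].
rewrite -[lcoef _ _]/(pcoef f w).
have [->|/fb <-] := eqVneq (pcoef f w) 0; last by apply: homAZ; apply: homA_prod.
by rewrite scale0r; apply: homA0.
Qed.

Lemma clsA_sum (f : Aelt K) : clsA f = \sum_(m <- f) clsA [:: m].
Proof. by elim: f => [|m f IH]; rewrite ?big_nil // big_cons clsA_cons IH. Qed.

Lemma Ahomog_filter b (a : Aelt K) : Ahomog b a ->
  clsA a = clsA [seq m <- a | odd (size m.2.2) == b].
Proof.
move=> ab; apply/eqP; rewrite -subr_eq0 -scaleN1r -clsAZ -clsAD; apply/eqP/clsA_eq0 => S T.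
have -> f g : acoef (f ++ Ascale (-1) g) S T = acoef f S T - acoef g S T.
  rewrite /acoef big_cat big_map /= -sumrN; congr (_ + _).
  by apply: eq_bigr => m _; rewrite !mulNr mul1r.
rewrite {2}/acoef big_filter_cond.
rewrite (eq_bigl (fun m => (odd (size T) == b) &&
   ((sort leq m.2.1 == S) && (sort leq m.2.2 == T)))); last first.
  by move=> [c [u v]] /=; have [<-|] := eqVneq (sort leq v) T; rewrite ?andbF // size_sort.
case: eqVneq => [_|oT] /=; first by rewrite -/(acoef a S T) subrr.
rewrite big_pred0_eq subr0; apply/eqP; apply: contraNT oT => /ab ->.
by rewrite eqxx.
Qed.

Lemma homA_Ahomog b (a : Aelt K) : Ahomog b a -> homA b (clsA a).
Proof.
move=> /Ahomog_filter->; pose F (c : bool) := [seq m <- a | wcolor c b m].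
exists (clsA (F false)), (clsA (F true)); split.
- by exists (F false); rewrite ?filter_all.
- by exists (F true); rewrite ?filter_all.
rewrite clsA_sum [clsA (F _)]clsA_sum [clsA (F true)]clsA_sum !big_filter.
rewrite (bigID (fun m => odd (size m.2.1))) /= addrC.
by congr (_ + _); apply: eq_bigl => m; rewrite /wcolor andbC; case: odd.
Qed.

Lemma clsA_Aeval phi f : clsA (Aeval phi f) = ev (fun x => clsA (phi x)) f.
Proof.
rewrite /Aeval /ev /leval; elim: f => [|m f IH]; first by rewrite big_nil.
rewrite big_cons -IH /= clsAD clsAZ; congr (_ *: _ + _).
elim: (m.2) => [|x w IHw]; first by rewrite big_nil.
by rewrite big_cons -IHw -clsAM.
Qed.

Lemma color_homA_comm b b' p q : color false b p -> homA b' q ->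
  p * q = sg (b && b') *: (q * p).
Proof.
move=> hp [s [t [hs ht ->]]].
by rewrite mulrDl mulrDr scalerDr (color_comm hp hs) (color_comm hp ht).
Qed.

(** The products s s', s t' and t s' obey the sign of the second factor alone and cancel; t t' has
    the extra sign -1 of the first factor and is doubled. *)
Lemma homA_scomm b b' s t s' t' : color false b s -> color true b t ->
  color false b' s' -> color true b' t' ->
  (s + t) * (s' + t') - sg (b && b') *: ((s' + t') * (s + t)) = 2%:R *: (t * t').
Proof.
move=> hs ht hs' ht'; rewrite !(mulrDl, mulrDr, scalerDr).
rewrite (color_comm hs hs') (color_comm hs ht') (color_comm ht hs') /=.
have -> : sg (b && b') *: (t' * t) = - (t * t').
  by rewrite (color_comm ht ht') /= /ksign signrN scaleNr opprK.
rewrite addrACA opprD [LHS]addrACA subrr add0r opprD opprK [LHS]addrACA subrr.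
by rewrite add0r -mulr2n scaler_nat.
Qed.

Lemma homA_odd_part (rho : var -> QA) : (forall x, homA (vdeg x) (rho x)) ->
  exists t : var -> QA, (forall x, color true (vdeg x) (t x)) /\
  forall x x', rho x * rho x' - sg (vdeg x && vdeg x') *: (rho x' * rho x) =
     2%:R *: (t x * t x').
Proof.
move=> rhoP.
have /choice[st stP] : forall x, exists st : QA * QA,
    [/\ color false (vdeg x) st.1, color true (vdeg x) st.2 & rho x = st.1 + st.2].
  by move=> x; have [s [t stP]] := rhoP x; exists (s, t).
exists (fun x => (st x).2); split=> [x|x x']; first by case: (stP x).
have [[h1 h2 ->] [h1' h2' ->]] := (stP x, stP x').
exact: homA_scomm.
Qed.

Section Identities.
Variable rho : var -> QA.
Hypothesis rhoP : forall x, homA (vdeg x) (rho x).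
Variable t : var -> QA.
Hypothesis tP : forall x, color true (vdeg x) (t x).
Hypothesis rho_scomm : forall x x',
  rho x * rho x' - sg (vdeg x && vdeg x') *: (rho x' * rho x) = 2%:R *: (t x * t x').

Let cxy x i : rho x * rho (yv i) - rho (yv i) * rho x = 2%:R *: (t x * t (yv i)).
Proof. by rewrite -rho_scomm andbF scale1r. Qed.

Let cyx x i : rho (yv i) * rho x - rho x * rho (yv i) = 2%:R *: (t (yv i) * t x).
Proof. by rewrite -rho_scomm scale1r. Qed.

Let czz i j : rho (zv i) * rho (zv j) + rho (zv j) * rho (zv i) =
  2%:R *: (t (zv i) * t (zv j)).
Proof. by rewrite -rho_scomm scaleN1r opprK. Qed.

Let texch a b c d : (t a * t b) * (t c * t d) =
  sg (~~ (vdeg b && vdeg c)) *: ((t a * t c) * (t b * t d)).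
Proof.
rewrite -mulrA (mulrA (t b)) (color_comm (tP b) (tP c)) /=.
by rewrite -!scalerAl -scalerAr !mulrA.
Qed.

Let tt_comm a b x : (t a * t b) * rho x =
  sg ((vdeg a (+) vdeg b) && vdeg x) *: (rho x * (t a * t b)).
Proof. by apply: color_homA_comm; [apply: (colorM (tP a) (tP b))|apply: rhoP]. Qed.

Let sg0 : sg false = 1. Proof. by []. Qed.
Let sg1 : sg true = -1. Proof. by []. Qed.

Arguments padd : simpl never.

(** Every inner bracket is 2 t t'. Then (1)-(4) express that t t' supercommutes with homogeneous
    elements, and (5)-(7) that two neighbouring t's can be exchanged. *)
Lemma ev_gens17 g : List.In g (gens17 K) -> ev rho g = 0.
Proof.
rewrite /gens17 /= /pcomm3 /y /z => g17.
do ![case: g17 => [<-|g17]];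
  rewrite !evE ?(cyx, cxy, czz) -?scalerAl -?scalerAr ?tt_comm.
(* The instances match only the first product of (5), (7) and (6), and turn it into the second up to
   sign. *)
all: rewrite -?scalerAl -?scalerAr ?(texch _ _ (zv 3) (zv 4)) ?(texch _ _ (yv 3) _).
all: by rewrite /= ?(sg0, sg1) ?scale1r ?scaleN1r ?scalerN ?subrr ?addNr.
Qed.
Hypothesis K2 : 2%:R != 0 :> K.

Let zsq i : rho (zv i) * rho (zv i) = t (zv i) * t (zv i).
Proof.
have /(congr1 ( *:%R 2%:R^-1)) := czz i i.
by rewrite -mulr2n -scaler_nat !scalerA mulVf // !scale1r.
Qed.

(** Collects all factors t_z in one power, so that (8) and (9) reduce to t_z^p = 0. *)
Lemma prod_scomm_pairs (I : Type) (c : I -> var) i (r : seq I) :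
  exists b, \prod_(j <- r) (t (c j) * t (zv i)) =
            sg b *: ((\prod_(j <- r) t (c j)) * t (zv i) ^+ size r).
Proof.
elim: r => [|j r [b IH]]; first by exists false; rewrite !big_nil mulr1 scale1r.
have [b' E] : exists b', t (zv i) * \prod_(j <- r) t (c j) =
    sg b' *: (\prod_(j <- r) t (c j) * t (zv i)).
  elim: r {IH} => [|k r [b' IH]]; first by exists false; rewrite !big_nil mulr1 mul1r scale1r.
  exists ((true && true (+) true && vdeg (c k)) (+) b').
  rewrite !big_cons mulrA (color_comm (tP (zv i)) (tP (c k))) -scalerAl -(mulrA (t (c k)) (t (zv i))) IH.
  by rewrite -scalerAr scalerA -ksign_addb mulrA.
exists (b (+) b'); rewrite !big_cons IH -scalerAr mulrA -(mulrA (t (c j)) (t (zv i))) E.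
by rewrite -scalerAr -scalerAl scalerA -ksign_addb /= exprS !mulrA.
Qed.

(** The commutators give 2k - 2 factors t_z, the circle product one, and z^(2n) = t_z^(2n) by [zsq]:
    p factors in total. *)
Lemma ev_id8 k n : (1 <= k)%N -> (2 * n + 2 * k - 1)%N \in [pchar K] ->
  ev rho (id8 K k n) = 0.
Proof.
move=> k1 pK; rewrite /id8 !evE ev_prod big_map /y /z.
under eq_bigr => i _ do rewrite ev_comm !ev_var cyx.
rewrite czz exprM expr2 zsq -expr2 -exprM -scalerAr -scalerAl.
rewrite scaler_prod.
have [b ->] := prod_scomm_pairs yv 1 (iota 1 (2 * k - 2)).
rewrite size_iota.
have [b' E] : exists b', t (zv 1) ^+ (2 * k - 2) * t (zv 2) =
    sg b' *: (t (zv 2) * t (zv 1) ^+ (2 * k - 2)).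
  elim: (2 * k - 2)%N => [|m [b' IH]]; first by exists false; rewrite mulr1 mul1r scale1r.
  exists b'; rewrite exprSr -mulrA (color_comm (tP (zv 1)) (tP (zv 2))) scale1r.
  by rewrite mulrA IH -scalerAl -mulrA -exprSr.
rewrite -!scalerAl -!mulrA [t (zv 1) ^+ _ * _]mulrA E.
rewrite -!scalerAl -!mulrA -exprS -exprD.
have -> : (2 * k - 2 + (2 * n).+1 = 2 * n + 2 * k - 1)%N by lia.
by rewrite (color11_pchar pK (tP (zv 1))) !(mulr0, scaler0).
Qed.

Lemma ev_id9 k n : (1 <= k)%N -> (2 * n + 2 * k - 1)%N \in [pchar K] ->
  ev rho (id9 K k n) = 0.
Proof.
move=> k1 pK; rewrite /id9 !evE ev_prod big_map /y /z.
under eq_bigr => i _ do rewrite ev_comm !ev_var cyx.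
rewrite exprM expr2 zsq -expr2 -exprM scaler_prod.
have [b ->] := prod_scomm_pairs yv 1 (iota 1 (2 * k - 1)).
rewrite size_iota -!scalerAl -mulrA -exprD.
have -> : (2 * k - 1 + 2 * n = 2 * n + 2 * k - 1)%N by lia.
by rewrite (color11_pchar pK (tP (zv 1))) !(mulr0, scaler0).
Qed.

End Identities.

Lemma T2ideal_sub_T2A (G : fpoly K -> Prop) f :
  (forall g, G g -> forall rho : var -> QA,
     (forall x, homA (vdeg x) (rho x)) -> ev rho g = 0) ->
  T2ideal G f -> T2A f.
Proof.
move=> GP fG phi phiP; apply/clsA_eq0; rewrite clsA_Aeval.
apply: ev_T2ideal fG => g sigma /GP gP sigmaP; apply: gP => x.
by apply: homA_ev (sigmaP x) => x'; apply/homA_Ahomog.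
Qed.

Lemma genI_sound g : genI g -> forall rho : var -> QA,
  (forall x, homA (vdeg x) (rho x)) -> ev rho g = 0.
Proof.
move=> g17 rho rhoP; have [t [tP tt]] := homA_odd_part rhoP.
exact: (ev_gens17 rhoP tP tt).
Qed.

Lemma genIp_sound n g : n \in [pchar K] -> (2 < n)%N -> genIp n g ->
  forall rho : var -> QA, (forall x, homA (vdeg x) (rho x)) -> ev rho g = 0.
Proof.
move=> nK n_gt2 [g17|[k [m [k1 [nE gE]]]]] rho rhoP; first exact: genI_sound.
have [t [tP tt]] := homA_odd_part rhoP.
have K2 : 2%:R != 0 :> K by rewrite -(dvdn_pcharf nK) gtnNdvd.
rewrite -nE in nK; case: gE => ->; first exact: (ev_id8 tP tt).
exact: (ev_id9 tP tt).
Qed.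

End Soundness.

(** * Normal forms *)

(** Adjacent transpositions generate all permutations. A general relation [P] lets signs and side
    conditions accumulate along the way. *)
Lemma perm_swap_ind (T : eqType) (P : seq T -> seq T -> Prop) :
  (forall s, P s s) -> (forall s t u, P s t -> P t u -> P s u) ->
  (forall s1 a b s2, P (s1 ++ [:: a, b & s2]) (s1 ++ [:: b, a & s2])) ->
  forall s t, perm_eq s t -> P s t.
Proof.
move=> Pr Pt Ps s t; rewrite -[s]/([::] ++ s) -[t]/([::] ++ t).
elim: s t [::] => [|a s IH] t p; first by rewrite perm_sym perm_cat2l => /perm_nilP->.
rewrite perm_cat2l => st; have ta : a \in t by rewrite -(perm_mem st) mem_head.
case/splitPr: ta st => t1 t2 st.
have {IH}/IH : perm_eq (rcons p a ++ s) (rcons p a ++ (t1 ++ t2)).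
  rewrite perm_cat2l -(perm_cons a); apply: perm_trans st _.
  by rewrite -cat1s perm_catCA.
rewrite !cat_rcons => /Pt; apply.
(* It remains to carry [a] to the right, past [t1]. *)
elim: t1 p {st} => [|x t1 IH] p; first exact: Pr.
apply: Pt (Ps _ _ _ _) _; rewrite /= -!(cat_rcons x p).
exact: IH.
Qed.

Section NormalForm.
Variables (K : fieldType) (R : algType K) (X : var -> R).
Local Notation sg := (ksign K).
Implicit Types u w : seq var.

Definition scomm a b := X a * X b - sg (vdeg a && vdeg b) *: (X b * X a).
Definition mon w := \prod_(x <- w) X x.

Fixpoint sprod u : R := if u is [:: a, b & u'] then scomm a b * sprod u' else 1.

(** The factorial condition covers both characteristics: it means multiplicity below p in
    characteristic p and is vacuous in characteristic 0. It is the factorial of [sum_sq0_pow]. *)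
Definition good u := all (fun x =>
  ((count_mem x u)`!%:R != 0 :> K) && (vdeg x || (count_mem x u <= 1)%N)) u.

Definition vsort u := sort (fun x y : var => (pickle x <= pickle y)%N) u.

Definition normal (b : seq var * seq var) :=
  [&& b.1 == vsort b.1, b.2 == vsort b.2, ~~ odd (size b.2), good b.2 &
      all (fun x => vdeg x ==> (count_mem x b.1 <= 1)%N) b.1].

Definition nform (b : seq var * seq var) := mon b.1 * sprod b.2.

Hypothesis K2 : 2%:R != 0 :> K.
Hypothesis scomm_X : forall a b c,
  scomm a b * X c = sg ((vdeg a (+) vdeg b) && vdeg c) *: (X c * scomm a b).
Hypothesis scomm_exch : forall a b c d,
  scomm a b * scomm c d = sg (~~ (vdeg b && vdeg c)) *: (scomm a c * scomm b d).
Hypothesis sprod_bad : forall u, ~~ odd (size u) -> ~~ good u -> sprod u = 0.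

Lemma scommC a b : scomm a b = sg (~~ (vdeg a && vdeg b)) *: scomm b a.
Proof.
rewrite /scomm scalerBr scalerA -ksign_addb (andbC (vdeg b)) addNb addbb.
by rewrite /ksign signrN !scaleNr scale1r opprK addrC.
Qed.

(** A swap inside a pair is [scommC], a swap across two pairs is [scomm_exch], and both cost the
    same sign. In odd length [sprod] would drop the last letter, hence the parity hypothesis. *)
Lemma sprod_swap s1 a b s2 : ~~ odd (size (s1 ++ [:: a, b & s2])) ->
  sprod (s1 ++ [:: a, b & s2]) =
  sg (~~ (vdeg a && vdeg b)) *: sprod (s1 ++ [:: b, a & s2]).
Proof.
move: s1 s2; fix IH 1; case=> [|c [|d s1]] s2.
- by move=> _ /=; rewrite [in LHS]scommC -scalerAl.
- case: s2 => [//|d s2] _ /=.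
  by rewrite !mulrA scomm_exch -scalerAl.
- by rewrite /= negbK => /IH ->; rewrite -scalerAr.
Qed.

Lemma sprod_perm u u' : perm_eq u u' -> ~~ odd (size u) ->
  exists b, sprod u = sg b *: sprod u'.
Proof.
move=> uu'; suff [] : size u = size u' /\
  (~~ odd (size u) -> exists b, sprod u = sg b *: sprod u') by [].
move: u u' uu'; apply: perm_swap_ind => [u|u v w [uv1 uv2] [vw1 vw2]|s1 a b s2].
- by split=> // _; exists false; rewrite scale1r.
- split=> [|ou]; first by rewrite uv1.
  have [b ->] := uv2 ou; have [|b' ->] := vw2; first by rewrite -uv1.
  by exists (b (+) b'); rewrite scalerA ksign_addb.
- split=> [|o]; first by rewrite !size_cat.
  by exists (~~ (vdeg a && vdeg b)); apply: sprod_swap.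
Qed.

Lemma scomm_mon a b w : exists e, scomm a b * mon w = sg e *: (mon w * scomm a b).
Proof.
elim: w => [|x w [e IH]]; first by exists false; rewrite /mon big_nil mulr1 mul1r scale1r.
exists ((vdeg a (+) vdeg b) && vdeg x (+) e).
rewrite /mon big_cons -/(mon w) mulrA scomm_X -scalerAl -(mulrA (X x) (scomm a b)) IH.
by rewrite -scalerAr scalerA ksign_addb mulrA.
Qed.

Definition VP : choiceType := (seq var * seq var)%type.

(** The content v is recorded because the independence argument compares terms of equal content. *)
Definition nspan v (r : R) := exists2 l : seq (K * VP),
  all (fun m => normal m.2 && perm_eq (m.2.1 ++ m.2.2) v) l & r = leval nform l.

Lemma nspan0 v : nspan v 0.
Proof. by exists [::]; rewrite // /leval big_nil. Qed.

Lemma nspanD v r r' : nspan v r -> nspan v r' -> nspan v (r + r').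
Proof.
by move=> [l lP ->] [l' lP' ->]; exists (l ++ l'); rewrite ?all_cat ?lP // leval_cat.
Qed.

Lemma nspanZ v c r : nspan v r -> nspan v (c *: r).
Proof.
by move=> [l lP ->]; exists (lscale c l); rewrite ?leval_scale // all_map.
Qed.

Lemma vsort_perm u u' : perm_eq u u' -> vsort u = vsort u'.
Proof.
move=> h; apply/perm_sortP => //; first by move=> x y; apply: leq_total.
- by move=> y x z; apply: leq_trans.
- by move=> x y /anti_leq /(pcan_inj pickleK).
Qed.

Lemma perm_vsort u : perm_eq u (vsort u).
Proof. by rewrite perm_sym perm_sort. Qed.

Lemma nspan_sprod v w u : perm_eq (w ++ u) v -> ~~ odd (size u) ->
  all (fun x => vdeg x ==> (count_mem x w <= 1)%N) w -> w = vsort w ->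
  nspan v (mon w * sprod u).
Proof.
move=> wv ou w1 ws; have [b E] := sprod_perm (perm_vsort u) ou.
have ou' : ~~ odd (size (vsort u)) by rewrite size_sort.
rewrite E -scalerAr; apply: nspanZ.
have [gu|/(sprod_bad ou')->] := boolP (good (vsort u)); last first.
  by rewrite mulr0; apply: nspan0.
exists [:: (1, (w, vsort u))]; last by rewrite /leval big_seq1 scale1r.
rewrite /= /normal /= -ws eqxx -(vsort_perm (perm_vsort u)) eqxx ou' gu w1 /= andbT.
by apply: perm_trans wv; rewrite perm_cat2l perm_sym perm_vsort.
Qed.

(** Letters of [w] can be permuted up to terms with a shorter [w]. So [w] can be sorted; if an odd
    letter occurs twice, its copies are brought together and their square, half a supercommutator,
    leaves [w]. *)
Lemma nspan_mon n v w u : (size w <= n)%N -> ~~ odd (size u) ->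
  perm_eq (w ++ u) v -> nspan v (mon w * sprod u).
Proof.
elim/ltn_ind: n w u => n IH w u wn ou wv.
(* The supercommutator created by a swap moves into the second word; the first one loses two
   letters, so the induction hypothesis applies. *)
have commute s1 a b s2 u' : (size s1 + size s2 < n)%N -> ~~ odd (size u') ->
    perm_eq (s1 ++ [:: a, b & s2] ++ u') v ->
    nspan v (mon s1 * (scomm a b * mon s2) * sprod u').
  move=> sn ou' sv; have [e ->] := scomm_mon a b s2.
  rewrite -scalerAr -scalerAl; apply: nspanZ.
  rewrite mulrA -!mulrA -[scomm a b * _]/(sprod [:: a, b & u']) mulrA.
  have -> : mon s1 * mon s2 = mon (s1 ++ s2) by rewrite /mon big_cat.
  apply: (IH _ sn); rewrite ?size_cat //= ?negbK //.
  apply/permP => p; rewrite -(permP sv) !count_cat /=; lia.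
have step s t : perm_eq s t -> (size s <= n)%N -> perm_eq (s ++ u) v ->
    nspan v (mon t * sprod u) -> nspan v (mon s * sprod u).
  (* [perm_eq s t] is carried along since transitivity needs the length and content of the
     intermediate word. *)
  move=> st; suff [] : perm_eq s t /\ ((size s <= n)%N -> perm_eq (s ++ u) v ->
      nspan v (mon t * sprod u) -> nspan v (mon s * sprod u)) by [].
  move: s t st; apply: perm_swap_ind => [s|s t r [st1 st2] [tr1 tr2]|s1 a b s2].
  - by split.
  - split=> [|sn sv nr]; first exact: perm_trans tr1.
    apply: st2 => //; apply: tr2 => //; first by rewrite -(perm_size st1).
    by apply: perm_trans sv; rewrite perm_cat2r perm_sym.
  - split; first by rewrite perm_cat2l (perm_catCA [:: a] [:: b]).
    rewrite size_cat /= => sn sv nt.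
    have -> : mon (s1 ++ [:: a, b & s2]) = mon s1 * (scomm a b * mon s2) +
        sg (vdeg a && vdeg b) *: mon (s1 ++ [:: b, a & s2]).
      rewrite /mon !big_cat !big_cons /= scalerAr -mulrDr; congr (_ * _).
      by rewrite !mulrA scalerAl -mulrDl subrK.
    rewrite mulrDl; apply: nspanD; last by rewrite -scalerAl; apply: nspanZ.
    apply: commute => //; last by rewrite catA.
    by apply: leq_trans sn; rewrite !addnS leqnSn.
have [w1|] := boolP (all (fun x => vdeg x ==> (count_mem x w <= 1)%N) w).
  apply: (step _ (vsort w)) => //; first exact: perm_vsort.
  apply: nspan_sprod => //; last exact: vsort_perm (perm_vsort w).
    by apply: perm_trans wv; rewrite perm_cat2r perm_sym perm_vsort.
  rewrite -(perm_all _ (perm_vsort w)); apply: etrans w1; apply: eq_all => x.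
  by rewrite -(permP (perm_vsort w)).
case/allPn => x xw; rewrite negb_imply -ltnNge => /andP[x1 x2].
have ww : perm_eq w [:: x, x & rem x (rem x w)].
  apply: perm_trans (perm_to_rem xw) _; rewrite perm_cons perm_to_rem //.
  by rewrite -has_pred1 has_count count_rem xw /= eqxx subn_gt0.
have sw := perm_size ww; rewrite /= in sw.
apply: (step _ _ ww) => //; rewrite /mon !big_cons mulrA -/(mon _).
have -> : X x * X x = 2%:R^-1 *: scomm x x.
  rewrite /scomm x1 /ksign scaleN1r opprK -mulr2n -scaler_nat scalerA mulVf //.
  by rewrite scale1r.
rewrite -!scalerAl; apply: nspanZ.
have := commute [::] x x (rem x (rem x w)) u; rewrite {1}/mon big_nil mul1r; apply=> //.
  by rewrite add0n; apply: leq_trans wn; rewrite sw leqnSn.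
by apply: perm_trans wv; move: ww; rewrite perm_sym -(perm_cat2r u).
Qed.

End NormalForm.

(** * Supercommutators in the relatively free algebra *)

Section Exchange.
Variables (K : fieldType) (R : algType K) (X : var -> R).
Local Notation sg := (ksign K).
Local Notation D := (scomm X).
Hypothesis scomm_X : forall a b c,
  D a b * X c = sg ((vdeg a (+) vdeg b) && vdeg c) *: (X c * D a b).

Lemma scomm_comm a b c d :
  D a b * D c d = sg ((vdeg a (+) vdeg b) && (vdeg c (+) vdeg d)) *: (D c d * D a b).
Proof.
have H x y : D a b * (X x * X y) =
    sg ((vdeg a (+) vdeg b) && (vdeg x (+) vdeg y)) *: (X x * X y * D a b).
  rewrite mulrA scomm_X -scalerAl -(mulrA (X x) (D a b)) scomm_X -scalerAr scalerA.
  by rewrite -ksign_addb -andb_addr mulrA.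
rewrite /D -/(D a b) mulrBr -scalerAr !H (addbC (vdeg d)) scalerA mulrC -scalerA.
by rewrite -scalerBr mulrBl -scalerAl.
Qed.

(** The relation is first known only for some degrees of the four letters; the lemmas below
    transport it along symmetries. *)
Definition exchange a b c d :=
  D a b * D c d = sg (~~ (vdeg b && vdeg c)) *: (D a c * D b d).

Local Notation exch := exchange.

Lemma exch_mid a b c d : exch a c b d -> exch a b c d.
Proof. by rewrite /exchange => ->; rewrite scalerA andbC -ksign_addb addbb scale1r. Qed.

Lemma exch_pairs a b c d : exch b a d c -> exch a b c d.
Proof.
rewrite /exchange (scommC _ a b) (scommC _ c d) -scalerAl -scalerAr => ->.
rewrite scomm_comm !scalerA -!ksign_addb; congr (sg _ *: _).
by do 4!case: (vdeg _).
Qed.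

Lemma exch_rev a b c d : exch d c b a -> exch a b c d.
Proof.
move=> E; rewrite /exchange (scommC _ a b) (scommC _ c d) (scommC _ a c) (scommC _ b d).
rewrite -!scalerAl -!scalerAr (scomm_comm b a) E (scomm_comm d b).
rewrite !scalerA -!ksign_addb; congr (sg _ *: _).
by do 4!case: (vdeg _).
Qed.

(** Four letters can be paired in three ways; if one pairing agrees up to sign with the other two,
    these agree with each other. *)
Lemma exch_trans a b c d : exch a b c d -> exch a b d c -> exch a c d b.
Proof.
rewrite /exchange => E1 E2; rewrite (scommC _ d b) -scalerAr (scommC _ c b) -scalerAr.
have -> : D a d * D b c = sg (~~ (vdeg b && vdeg d)) *: (D a b * D d c).
  by rewrite E2 scalerA -ksign_addb addbb scale1r.
rewrite (scommC _ d c) -scalerAr E1 !scalerA -!ksign_addb; congr (sg _ *: _).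
by do 4!case: (vdeg _).
Qed.

End Exchange.

Section RingIdentities.
Variable R : nzRingType.
Implicit Types y z : R.

(** The derivation [y, -] sends z o z' to [y,z] o z' + z o [y,z'], where o is the circle product;
    (3) kills both terms. *)
Lemma circ_comm_of_comm_circ y z z' :
  (y * z - z * y) * z' + z' * (y * z - z * y) = 0 ->
  (y * z' - z' * y) * z + z * (y * z' - z' * y) = 0 ->
  (z * z' + z' * z) * y = y * (z * z' + z' * z).
Proof.
set A := y * z - z * y; set B := y * z' - z' * y => HA HB.
have yz : y * z = z * y + A by rewrite /A addrC subrK.
have yz' : y * z' = z' * y + B by rewrite /B addrC subrK.
clearbody A B.
have Az : A * z' = - (z' * A) by apply/eqP; rewrite -addr_eq0 HA.
have Bz : B * z = - (z * B) by apply/eqP; rewrite -addr_eq0 HB.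
rewrite mulrDr !mulrA yz yz' !mulrDl -!mulrA yz yz' Az Bz !mulrDr.
by rewrite [RHS]addrACA -opprD [X in _ = X - _]addrACA (addrC (z' * A)) addrK.
Qed.

(** Expand [y, y' z] = [y,y'] z + y' [y,z] in the first hypothesis and move z' to the right of
    [y,y'] and to the left of [y,z] by the other two. *)
Lemma comm_circ_mul y y' z z' :
  (y * (y' * z) - y' * z * y) * z' + z' * (y * (y' * z) - y' * z * y) = 0 ->
  (y * y' - y' * y) * z' = z' * (y * y' - y' * y) ->
  (y * z - z * y) * z' + z' * (y * z - z * y) = 0 ->
  (y * y' - y' * y) * (z * z' + z' * z) = (y' * z' - z' * y') * (y * z - z * y).
Proof.
set C := y * y' - y' * y; set B := y * z - z * y => H HC HB.
have yy : y * y' = y' * y + C by rewrite /C addrC subrK.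
have yz : y * z = z * y + B by rewrite /B addrC subrK.
clearbody C B.
have Bz : B * z' = - (z' * B) by apply/eqP; rewrite -addr_eq0 HB.
have E : y * (y' * z) - y' * z * y = C * z + y' * B.
  by rewrite mulrA yy mulrDl -mulrA yz mulrDr -!mulrA addrAC (addrC (y' * (z * y))) addrK addrC.
move: H; rewrite E mulrDl mulrDr -(mulrA y' B) Bz mulrN (mulrA z' C) -HC.
rewrite addrACA -!mulrA -mulrDr => /eqP; rewrite addr_eq0 => /eqP ->.
by rewrite opprD opprK mulrBl !mulrA.
Qed.

End RingIdentities.

(** * Consequences of (1)-(7) in the relatively free algebra *)

Section Relations.
Variables (K : fieldType) (G : fpoly K -> Prop).
Hypothesis G1 : ~ T2ideal G (pone K).
Hypothesis G17 : forall g, List.In g (gens17 K) -> G g.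
Hypothesis K2 : 2%:R != 0 :> K.
Local Notation sg := (ksign K).
Local Notation QG := (QG G1).
Local Notation X := (XG G1).
Local Notation D := (scomm X).

Definition homG (b : bool) (q : QG) := exists f, phomog b f /\ q = ev X f.

Lemma homG0 b : homG b 0.
Proof.
exists [::]; rewrite ev_nil; split=> // w.
by rewrite /pcoef big_nil eqxx.
Qed.

Lemma phomog_word b (c : K) w : wdeg w = b -> phomog b [:: (c, w)].
Proof.
move=> wb w'; rewrite /pcoef big_mkcond big_seq1 /=.
by case: (w =P w') => [<- //|_]; rewrite eqxx.
Qed.

Lemma homG_X x : homG (vdeg x) (X x).
Proof.
exists (pvar K x); rewrite ev_var; split=> //; apply: phomog_word.
by rewrite /wdeg /= addn0 oddb.
Qed.

Lemma homG_XX x x' : homG (vdeg x (+) vdeg x') (X x * X x').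
Proof.
exists (pmul (pvar K x) (pvar K x')); rewrite evM !ev_var; split=> //.
by apply: phomog_word; rewrite /wdeg /= addn0 oddD !oddb.
Qed.

(* Position i of l (counted from 1) is the value of y_i or z_i, according to the
   degree given there; the other variable of index i is sent to 0. *)
Definition assign (l : seq (bool * QG)) (x : var) : QG :=
  let a := nth (false, 0) ((false, 0) :: l) x.2 in if a.1 == x.1 then a.2 else 0.

Lemma ev_assign l g : G g -> List.Forall (fun a => homG a.1 a.2) l ->
  ev (assign l) g = 0.
Proof.
move=> Gg lP; apply: ev_gen Gg _ => -[b i]; rewrite -/(homG _ _) /assign /=.
case: i => [|i] /=; first by case: ifP => _; apply: homG0.
have H : forall i, homG (nth (false, 0) l i).1 (nth (false, 0) l i).2.
  elim: lP => [|a l' ha _ IH] [|j] //=; exact: homG0.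
by case: eqP => [<-|_]; [apply: H|apply: homG0].
Qed.

Section Values.
Variables (a b c d : QG).

(** This lemma and the next ones allow arbitrary homogeneous values, since [exch_yyzz] uses (3) at a
    product of two variables. *)
Lemma QG_yyx i : homG false a -> homG false b -> homG i c ->
  (a * b - b * a) * c = c * (a * b - b * a).
Proof.
move=> ha hb hc; apply/eqP; rewrite -subr_eq0; apply/eqP.
have := @ev_assign [:: (false, a); (false, b); (i, c)]
  (pcomm3 (y K 1) (y K 2) (pvar K (i, 3))).
rewrite !evE /assign /= eqxx; apply; last by repeat constructor.
by case: i hc => _; apply: G17; do ?[by left|right].
Qed.

Lemma QG_yzy : homG false a -> homG true b -> homG false c ->
  (a * b - b * a) * c = c * (a * b - b * a).
Proof.
move=> ha hb hc; apply/eqP; rewrite -subr_eq0; apply/eqP.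
have := @ev_assign [:: (false, a); (true, b); (false, c)]
  (pcomm3 (y K 1) (z K 2) (y K 3)).
by rewrite !evE; apply; [apply: G17; do ?[by left|right]|repeat constructor].
Qed.

Lemma QG_yzz : homG false a -> homG true b -> homG true c ->
  (a * b - b * a) * c + c * (a * b - b * a) = 0.
Proof.
move=> ha hb hc.
have := @ev_assign [:: (false, a); (true, b); (true, c)]
  (pcirc (pcomm (y K 1) (z K 2)) (z K 3)).
by rewrite !evE; apply; [apply: G17; do ?[by left|right]|repeat constructor].
Qed.

Lemma QG_zzz : homG true a -> homG true b -> homG true c ->
  (a * b + b * a) * c = c * (a * b + b * a).
Proof.
move=> ha hb hc; apply/eqP; rewrite -subr_eq0; apply/eqP.
have := @ev_assign [:: (true, a); (true, b); (true, c)]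
  (pcomm (pcirc (z K 1) (z K 2)) (z K 3)).
by rewrite !evE; apply; [apply: G17; do ?[by left|right]|repeat constructor].
Qed.

Lemma QG_zzzz : homG true a -> homG true b -> homG true c -> homG true d ->
  (a * b + b * a) * (c * d + d * c) = (a * c + c * a) * (b * d + d * b).
Proof.
move=> ha hb hc hd; apply/eqP; rewrite -subr_eq0; apply/eqP.
have := @ev_assign [:: (true, a); (true, b); (true, c); (true, d)]
  (psub (pmul (pcirc (z K 1) (z K 2)) (pcirc (z K 3) (z K 4)))
        (pmul (pcirc (z K 1) (z K 3)) (pcirc (z K 2) (z K 4)))).
by rewrite !evE; apply; [apply: G17; do ?[by left|right]|repeat constructor].
Qed.

Lemma QG_xyyx i j : homG i a -> homG false b -> homG false c -> homG j d ->
  (a * b - b * a) * (c * d - d * c) = - ((a * c - c * a) * (b * d - d * b)).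
Proof.
move=> ha hb hc hd; apply/eqP; rewrite -addr_eq0; apply/eqP.
have := @ev_assign [:: (i, a); (false, b); (false, c); (j, d)]
  (padd (pmul (pcomm (pvar K (i, 1)) (y K 2)) (pcomm (y K 3) (pvar K (j, 4))))
        (pmul (pcomm (pvar K (i, 1)) (y K 3)) (pcomm (y K 2) (pvar K (j, 4))))).
rewrite !evE /assign /= !eqxx; apply; last by repeat constructor.
by case: i j ha hd => [] [] _ _; apply: G17; do ?[by left|right].
Qed.

Lemma QG_yzzz : homG false a -> homG true b -> homG true c -> homG true d ->
  (a * b - b * a) * (c * d + d * c) = (a * c - c * a) * (b * d + d * b).
Proof.
move=> ha hb hc hd; apply/eqP; rewrite -subr_eq0; apply/eqP.
have := @ev_assign [:: (false, a); (true, b); (true, c); (true, d)]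
  (psub (pmul (pcomm (y K 1) (z K 2)) (pcirc (z K 3) (z K 4)))
        (pmul (pcomm (y K 1) (z K 3)) (pcirc (z K 2) (z K 4)))).
by rewrite !evE; apply; [apply: G17; do ?[by left|right]|repeat constructor].
Qed.

End Values.

Lemma scomm_yx a b : vdeg a && vdeg b = false -> D a b = X a * X b - X b * X a.
Proof. by rewrite /scomm => ->; rewrite scale1r. Qed.

Lemma scomm_zz a b : vdeg a -> vdeg b -> D a b = X a * X b + X b * X a.
Proof. by rewrite /scomm => -> ->; rewrite scaleN1r opprK. Qed.

(** All cases are instances of (1)-(4), up to antisymmetry, except two odd entries against an even
    variable, which [circ_comm_of_comm_circ] derives from (3). *)
Lemma scomm_QG a b c :
  D a b * X c = sg ((vdeg a (+) vdeg b) && vdeg c) *: (X c * D a b).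
Proof.
have yz i j k : D (yv i) (zv j) * X k = sg (vdeg k) *: (X k * D (yv i) (zv j)).
  rewrite scomm_yx //; case: k => [[] k] /=.
    rewrite scaleN1r; apply/eqP; rewrite -addr_eq0; apply/eqP.
    exact: (QG_yzz (homG_X (yv i)) (homG_X (zv j)) (homG_X (zv k))).
  rewrite scale1r.
  exact: (QG_yzy (homG_X (yv i)) (homG_X (zv j)) (homG_X (yv k))).
case: a b => [[] i] [[] j] /=.
- rewrite scale1r scomm_zz //; case: c => [[] k].
    exact: (QG_zzz (homG_X (zv i)) (homG_X (zv j)) (homG_X (zv k))).
  apply: circ_comm_of_comm_circ.
    exact: (QG_yzz (homG_X (yv k)) (homG_X (zv i)) (homG_X (zv j))).
  exact: (QG_yzz (homG_X (yv k)) (homG_X (zv j)) (homG_X (zv i))).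
- rewrite scommC -scalerAl -scalerAr yz !scalerA; congr (_ *: _).
  exact: mulrC.
- exact: yz.
- rewrite scale1r scomm_yx //.
  exact: (QG_yyx (homG_X (yv i)) (homG_X (yv j)) (homG_X c)).
Qed.

Local Notation exch := (exchange X).

Let exch_xyyx a b c d : ~~ vdeg b -> ~~ vdeg c -> exch a b c d.
Proof.
move=> /negPf b0 /negPf c0; rewrite /exchange !scomm_yx ?b0 ?c0 ?andbF //.
rewrite scaleN1r; apply: QG_xyyx (homG_X a) _ _ (homG_X d).
  by rewrite -b0; apply: homG_X.
by rewrite -c0; apply: homG_X.
Qed.

(* This is (3) with z_2 replaced by y_2 z_2. *)
Let exch_yyzz i j k l : exch (yv i) (yv j) (zv k) (zv l).
Proof.
rewrite /exchange; transitivity (D (yv j) (zv l) * D (yv i) (zv k)); last first.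
  exact: (scomm_comm scomm_QG).
rewrite (@scomm_zz (zv k)) // !scomm_yx //; apply: comm_circ_mul.
- exact: (QG_yzz (homG_X (yv i)) (homG_XX (yv j) (zv k)) (homG_X (zv l))).
- exact: (QG_yyx (homG_X (yv i)) (homG_X (yv j)) (homG_X (zv l))).
- exact: (QG_yzz (homG_X (yv i)) (homG_X (zv k)) (homG_X (zv l))).
Qed.

Let exch_yzzz i j k l : exch (yv i) (zv j) (zv k) (zv l).
Proof.
rewrite /exchange !(@scomm_yx (yv i)) // !scomm_zz //= scale1r.
exact: (QG_yzzz (homG_X (yv i)) (homG_X (zv j)) (homG_X (zv k)) (homG_X (zv l))).
Qed.

Let exch_zzzz i j k l : exch (zv i) (zv j) (zv k) (zv l).
Proof.
rewrite /exchange !scomm_zz //= scale1r.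
exact: (QG_zzzz (homG_X (zv i)) (homG_X (zv j)) (homG_X (zv k)) (homG_X (zv l))).
Qed.

(** The sixteen degree patterns are reduced by symmetry to (5), (6), (7) and [exch_yyzz]; the
    pattern y, z, z, y combines two instances of the latter. *)
Lemma exch_QG a b c d : exch a b c d.
Proof.
have rev := exch_rev scomm_QG; have pairs := exch_pairs scomm_QG.
have mid := @exch_mid K _ X.
case: a b c d => [[] i] [[] j] [[] k] [[] l]; try by apply: exch_xyyx.
- exact: exch_zzzz.
- exact/rev/exch_yzzz.
- exact/mid/pairs/exch_yzzz.
- exact/mid/pairs/mid/exch_yyzz.
- exact/pairs/exch_yzzz.
- exact/pairs/mid/exch_yyzz.
- exact: exch_yzzz.
- exact: (exch_trans (exch_yyzz i l j k) (exch_yyzz i l k j)).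
- exact/mid/exch_yyzz.
- exact/mid/rev/pairs/exch_xyyx.
- exact: exch_yyzz.
- exact/rev/pairs/exch_xyyx.
Qed.

Hypothesis sprod_fact : forall x u, vdeg x -> ~~ odd (size u) ->
  (count_mem x u)`!%:R = 0 :> K -> sprod X u = 0.

(** Two copies of an even variable can be gathered in one pair, where [y,y] = 0. For an even
    variable a vanishing factorial already forces such a repetition. *)
Lemma sprod_bad u : ~~ odd (size u) -> ~~ good K u -> sprod X u = 0.
Proof.
move=> ou /allPn[x xu]; rewrite negb_and negbK negb_or -ltnNge.
have yrep : ~~ vdeg x -> (1 < count_mem x u)%N -> sprod X u = 0.
  move=> x0 x2; have uu : perm_eq u [:: x, x & rem x (rem x u)].
    apply: perm_trans (perm_to_rem xu) _; rewrite perm_cons perm_to_rem //.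
    by rewrite -has_pred1 has_count count_rem xu /= eqxx subn_gt0.
  have [b ->] := sprod_perm exch_QG uu ou.
  by rewrite /= scomm_yx ?(negPf x0) // subrr mul0r scaler0.
case/orP=> [/eqP f0|/andP[]]; last exact: yrep.
have [x1|x0] := boolP (vdeg x); first exact: sprod_fact f0.
apply: yrep => //; rewrite ltnNge; apply: contra_eqN f0.
by case: count => [|[|]] // _; rewrite oner_neq0.
Qed.

Lemma nspan_word v : nspan X v (mon X v).
Proof.
have := @nspan_mon K QG X K2 scomm_QG exch_QG sprod_bad _ v v [::] (leqnn _) isT.
by rewrite cats0 /= mulr1; apply.
Qed.

End Relations.

Lemma fact_pchar (K : fieldType) p n : p \in [pchar K] -> (n`!%:R == 0 :> K) = (p <= n)%N.
Proof.
move=> pK; have pp : prime p by case/andP: pK.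
rewrite -(dvdn_pcharf pK); apply/idP/idP => [|pn]; last first.
  by rewrite dvdn_fact // prime_gt0.
elim: n => [|n IH]; first by rewrite dvdn1 => /eqP p1; rewrite p1 in pp.
rewrite factS Euclid_dvdM // => /orP[/dvdn_leq->//|/IH/leqW//].
Qed.

(** * Consequences of (8) and (9) in characteristic p *)

Section PositiveCharacteristic.
Variables (K : fieldType) (p : nat).
Hypothesis pK : p \in [pchar K].
Hypothesis p_gt2 : (2 < p)%N.
Hypothesis G1 : ~ T2ideal (@genIp K p) (pone K).
Local Notation X := (XG G1).
Local Notation D := (scomm X).

Let G17 g : List.In g (gens17 K) -> genIp p g. Proof. by left. Qed.

Lemma pchar_neq2 : 2%:R != 0 :> K.
Proof. by rewrite -(dvdn_pcharf pK) gtnNdvd. Qed.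

Let n := (p.-1)./2.
Let pE : (2 * n + 1 = p)%N.
Proof.
have pp : prime p by case/andP: pK.
have [p2|op] := even_prime pp; first by have := p_gt2; rewrite p2.
by rewrite /n; have := p_gt2; lia.
Qed.

Let gen89 f : f = id8 K 1 n \/ f = id9 K 1 n -> genIp p f.
Proof. by move=> fE; right; exists 1%N, n; split=> //; split=> //; rewrite -pE; lia. Qed.

Let scomm_pow a x : vdeg x -> D a x * X x ^+ (2 * n) = 0.
Proof.
case: x => -[] // j _; case: a => [[] i].
  have := @ev_assign K _ G1 [:: (true, X (zv j)); (true, X (zv i))] (id8 K 1 n).
  rewrite /id8 !evE /= mul1r scomm_zz //; apply; first by apply: gen89; left.
  have h k := homG_X G1 (zv k).
  by constructor; [apply: h|constructor; [apply: h|constructor]].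
(* (9) involves both y_1 and z_1, while [assign] serves only one variable per index. *)
pose rho (x : var) := if x.2 == 1%N then X (if x.1 then zv j else yv i) else 0.
have := @ev_gen K _ G1 (id9 K 1 n) rho; rewrite /id9 evM ev_prod big_map ev_pow big_seq1.
rewrite !evE scomm_yx //; apply; first by apply: gen89; right.
move=> [b k]; rewrite -/(homG _ _) /rho /=; case: eqP => _; last exact: homG0.
by case: b; [exact: (homG_X G1 (zv j))|exact: (homG_X G1 (yv i))].
Qed.

(** As p is odd and [u] has even length, some letter [a] is left besides p copies of [x]. Pairing
    [a] with one copy and the other p - 1 = 2n copies among themselves gives a multiple of the
    product in [scomm_pow]. *)
Lemma pchar_sprod_fact x u : vdeg x -> ~~ odd (size u) ->
  (count_mem x u)`!%:R = 0 :> K -> sprod X u = 0.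
Proof.
move=> x1 ou /eqP; rewrite (fact_pchar _ pK) => pu.
pose r := nseq (count_mem x u - p) x ++ filter (predC (pred1 x)) u.
have ur : perm_eq u (nseq p x ++ r).
  rewrite /r catA -nseqD subnKC // perm_sym.
  have -> : nseq (count_mem x u) x = filter (pred1 x) u.
    by rewrite -size_filter; apply/esym/all_pred1P/filter_all.
  by rewrite perm_filterC.
have [a [r' rE]] : exists a r', r = a :: r'.
  case: {-1}r (erefl r) => [r0|a r' _]; last by exists a, r'.
  by move: ou; rewrite (perm_size ur) r0 cats0 size_nseq -pE mul2n addn1 /= odd_double.
have {}ur : perm_eq u [:: a, x & nseq (2 * n) x ++ r'].
  by apply: perm_trans ur _; rewrite rE -pE addn1 perm_catC /= perm_cons perm_catC.
have [b ->] := sprod_perm (exch_QG G1 G17) ur ou.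
have XX : scomm X x x = 2%:R *: X x ^+ 2.
  by rewrite scomm_zz // -mulr2n scaler_nat expr2.
have E m : sprod X (nseq (2 * m) x ++ r') = 2%:R ^+ m *: (X x ^+ (2 * m) * sprod X r').
  elim: m => [|m IH]; first by rewrite scale1r mul1r.
  by rewrite mulnS /= IH XX -scalerAl -scalerAr scalerA mulrA -exprD -exprS.
by rewrite /= E -scalerAr mulrA scomm_pow // mul0r !scaler0.
Qed.

Lemma nspan_word_pchar v : nspan X v (mon X v).
Proof. exact: (nspan_word G17 pchar_neq2 pchar_sprod_fact). Qed.

End PositiveCharacteristic.

Section CharacteristicZero.
Variable K : fieldType.
Hypothesis K0 : [pchar K] =i pred0.
Hypothesis G1 : ~ T2ideal (@genI K) (pone K).

Lemma pchar0_natr n : (n%:R == 0 :> K) = (n == 0%N).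
Proof. by move: n; apply/pcharf0P. Qed.

Lemma nspan_word_pchar0 v : nspan (XG G1) v (mon (XG G1) v).
Proof.
apply: nspan_word => //; first by rewrite pchar0_natr.
by move=> x u _ _ /eqP; rewrite pchar0_natr -leqn0 leqNgt fact_gt0.
Qed.

End CharacteristicZero.

(** * Reduction to multihomogeneous identities *)

Section Homogeneous.
Variable K : fieldType.
Hypothesis Kinf : forall s : seq K, exists x : K, x \notin s.

Lemma infinite_uniq n : exists2 s : seq K, uniq s & size s = n.
Proof.
elim: n => [|n [s su sn]]; first by exists [::].
by have [x xs] := Kinf s; exists (x :: s); rewrite /= ?xs ?sn.
Qed.

Lemma poly_eq0_infinite (p : {poly K}) : (forall t, p.[t] = 0) -> p = 0.
Proof.
move=> p0; apply/eqP; apply: contraT => pn0.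
have [s su ss] := infinite_uniq (size p).
have := max_poly_roots pn0 _ su; rewrite ss ltnn; apply.
by apply/allP => t _; apply/eqP.
Qed.

Lemma acoef_cls (a b : Aelt K) S T : clsA a = clsA b -> acoef a S T = acoef b S T.
Proof.
move/eqP; rewrite -subr_eq0 -scaleN1r -clsAZ -clsAD => /eqP/clsA_eq0/(_ S T).
rewrite /acoef big_cat big_map /= => /eqP; rewrite addr_eq0 -sumrN => /eqP->.
by apply: eq_bigr => m _; rewrite !mulNr mul1r opprK.
Qed.

Lemma acoefZ c (a : Aelt K) S T : acoef (Ascale c a) S T = c * acoef a S T.
Proof.
by rewrite /acoef big_map mulr_sumr; apply: eq_bigr => m _ /=; rewrite !mulrA.
Qed.

Lemma acoef_Aeval phi (f : fpoly K) S T : acoef (Aeval phi f) S T =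
  \sum_(m <- f) m.1 * acoef (foldr (@Amul K) (Aone K) [seq phi x | x <- m.2]) S T.
Proof.
elim: f => [|m f IH]; first by rewrite /acoef !big_nil.
by rewrite big_cons -IH -acoefZ {1}/acoef big_cat.
Qed.

(** Replacing x by t x makes each coordinate of the value a polynomial in t that vanishes on the
    infinite field K; its coefficient of degree d is the coordinate for the filtered list. *)
Lemma T2A_count x d (f : fpoly K) : T2A f ->
  T2A [seq m <- f | count_mem x m.2 == d].
Proof.
move=> f0 phi phiP S T.
pose q w := acoef (foldr (@Amul K) (Aone K) [seq phi x | x <- w]) S T.
pose P : {poly K} := \sum_(m <- f) (m.1 * q m.2) *: 'X^(count_mem x m.2).
have P0 : P = 0.
  apply: poly_eq0_infinite => t.
  pose phit v := if v == x then Ascale t (phi v) else phi v.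
  have phitP v : Ahomog (vdeg v) (phit v).
    rewrite /phit; case: eqP => _; last exact: phiP.
    move=> S' T'; rewrite acoefZ => h; apply: (phiP v S' T').
    by apply: contra_neq h => ->; rewrite mulr0.
  rewrite -[RHS](f0 phit phitP S T).
  rewrite acoef_Aeval horner_sum; apply: eq_bigr => m _.
  rewrite hornerZ hornerXn -mulrA; congr (_ * _).
  rewrite mulrC -acoefZ; apply: acoef_cls; rewrite clsAZ.
  elim: (m.2) => [|v w IH]; first by rewrite /= expr0 scale1r.
  rewrite /= !clsAM -IH -scalerAr /phit; case: eqP => _; last by rewrite add0n.
  by rewrite clsAZ -scalerAl scalerA exprD expr1 mulrC.
have := congr1 (fun p : {poly K} => p`_d) P0.
rewrite coef0 coef_sum acoef_Aeval big_filter => E; rewrite -[RHS]E big_mkcond /=.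
apply: eq_bigr => m _; rewrite coefZ coefXn eq_sym -/(q _).
by case: eqP => _; rewrite ?mulr1 ?mulr0.
Qed.

Lemma T2A_perm v (f : fpoly K) : T2A f -> T2A [seq m <- f | perm_eq m.2 v].
Proof.
(* Letters outside [s] occur neither in [v] nor in [f], so finitely many uses of [T2A_count]
   suffice. *)
move=> f0; pose s := v ++ flatten [seq m.2 | m <- f].
have -> : [seq m <- f | perm_eq m.2 v] =
          [seq m <- f | all (fun x => count_mem x m.2 == count_mem x v) s].
  apply: eq_in_filter => m mf; apply/idP/allP => [/permP h x _|h]; first by rewrite h.
  apply/allP => x; rewrite mem_cat => /orP[] xs; apply: h; rewrite mem_cat ?xs ?orbT //.
  apply/orP; right; apply/flattenP; exists m.2 => //; exact: map_f.
elim: s => [|x s IH]; first by rewrite filter_predT.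
by rewrite filter_predI; apply: T2A_count.
Qed.

Lemma T2A_psub (f g : fpoly K) : T2A f -> T2A g -> T2A (psub f g).
Proof.
move=> f0 g0 phi phiP; apply/clsA_eq0; rewrite clsA_Aeval evB -!clsA_Aeval.
by rewrite !(proj2 (clsA_eq0 _)) ?subrr //; [apply: g0|apply: f0].
Qed.

Lemma T2A_ext (f g : fpoly K) : (forall w, pcoef f w = pcoef g w) -> T2A f -> T2A g.
Proof.
move=> fg f0 phi phiP; apply/clsA_eq0; rewrite clsA_Aeval -(ev_ext _ fg) -clsA_Aeval.
by apply/clsA_eq0/f0.
Qed.

Lemma pcoef_split (P : pred (K * seq var)) (f : fpoly K) w :
  pcoef f w = pcoef ([seq m <- f | P m] ++ [seq m <- f | predC P m]) w.
Proof. by rewrite /pcoef; apply/esym/perm_big; rewrite perm_filterC. Qed.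

Lemma T2A_homog_ind (I : fpoly K -> Prop) :
  I [::] -> (forall f g, I f -> I g -> I (f ++ g)) ->
  (forall f g, (forall w, pcoef f w = pcoef g w) -> I f -> I g) ->
  (forall v f, all (fun m => perm_eq m.2 v) f -> T2A f -> I f) ->
  forall f, T2A f -> I f.
Proof.
move=> I0 ID Iext Ihom f; elim: (size f) {-2}f (leqnn (size f)) => {f} [|n IH] f.
  by rewrite leqn0 size_eq0 => /eqP-> _.
case: f => [|m f] // fn f0; set F := m :: f in f0 *.
pose P (k : K * seq var) := perm_eq k.2 m.2.
apply: (Iext _ _ (fun w => esym (pcoef_split P F w))); apply: ID.
  by apply: (Ihom m.2); [apply: filter_all|apply: T2A_perm].
apply: IH.
  rewrite /F /= /P perm_refl /=; apply: leq_trans (_ : size f <= n)%N => //.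
  by rewrite size_filter count_size.
apply: T2A_ext (T2A_psub f0 (T2A_perm m.2 f0)) => w.
have : pcoef (psub F [seq k <- F | P k]) w = pcoef F w - pcoef [seq k <- F | P k] w.
  by rewrite /pcoef big_cat big_map -sumrN /=; congr (_ + _); apply: eq_bigr => k _; rewrite mulN1r.
move=> ->; rewrite (pcoef_split P F).
by rewrite -[pcoef (_ ++ _) w]/(@lcoef K WV _ w) lcoef_cat addrC addKr.
Qed.

End Homogeneous.

(** * Linear independence of the normal forms *)

Section NormalPolynomials.
Variable K : fieldType.

(** Normal forms are also needed as polynomials, to be evaluated both in the relatively free algebra
    and in E (x) E. *)
Definition fscomm a b : fpoly K :=
  psub (pmul (pvar K a) (pvar K b))
       (pscale (ksign K (vdeg a && vdeg b)) (pmul (pvar K b) (pvar K a))).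

Fixpoint fsprod (u : seq var) : fpoly K :=
  if u is [:: a, b & u'] then pmul (fscomm a b) (fsprod u') else pone K.

Definition fnform (b : seq var * seq var) : fpoly K :=
  pmul (pprod [seq pvar K x | x <- b.1]) (fsprod b.2).

Lemma ev_fnform (V : algType K) (rho : var -> V) b : ev rho (fnform b) = nform rho b.
Proof.
case: b => w u; rewrite /fnform evM ev_prod big_map /nform /mon /=.
congr (_ * _); first by apply: eq_bigr => x _; rewrite ev_var.
move: u; fix IH 1; case=> [|a [|b u]] /=; rewrite ?ev1 //.
by rewrite evM IH /fscomm evB evZ !evM !ev_var.
Qed.

End NormalPolynomials.

Section PowerSum.
Variables (K : fieldType) (V : algType K) (om : nat -> V).
Hypothesis om2 : forall k, om k ^+ 2 = 0.
Hypothesis omC : forall j k, om j * om k = om k * om j.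

(** Since the new summand has square zero, only two binomial terms remain in each power; one
    induction proves both claims because each step uses both. *)
Lemma sum_sq0_pow n :
  (\sum_(k <- iota 0 n) om k) ^+ n = (n`!%:R : K) *: \prod_(k <- iota 0 n) om k /\
  (\sum_(k <- iota 0 n) om k) ^+ n.+1 = 0.
Proof.
have step S k m : S * om k = om k * S ->
    (S + om k) ^+ m.+1 = S ^+ m.+1 + (m.+1%:R : K) *: (S ^+ m * om k).
  move=> Sk; elim: m => [|m IH]; first by rewrite !expr1 expr0 mul1r scale1r.
  rewrite exprSr IH mulrDl !mulrDr -exprSr -!scalerAl -!mulrA -Sk -expr2 om2.
  rewrite mulr0 scaler0 addr0 -addrA mulrA -exprSr; congr (_ + _).
  by rewrite -[X in X + _]scale1r -scalerDl -mulrS.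
elim: n => [|n [IH1 IH2]]; first by rewrite !big_nil expr0n expr1 scale1r.
have -> : iota 0 n.+1 = rcons (iota 0 n) n by rewrite -addn1 iotaD cats1.
rewrite !big_rcons /= -/(GRing.add _ _).
have Sn : (\sum_(k <- iota 0 n) om k) * om n = om n * \sum_(k <- iota 0 n) om k.
  by rewrite mulr_suml mulr_sumr; apply: eq_bigr => k _; apply: omC.
rewrite !step // IH2 IH1 add0r exprS IH2 mulr0 mul0r scaler0 addr0; split=> //.
by rewrite -scalerAl scalerA -natrM factS.
Qed.

End PowerSum.

Section Independence.
Variable K : fieldType.
Local Notation QA := (QA K).
Local Notation sg := (ksign K).
Variables (w0 u0 : seq var).
Hypothesis w0_uniq : all (fun x => vdeg x ==> (count_mem x w0 <= 1)%N) w0.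
Hypothesis u0_good : good K u0.

(** [inl x] stands for the generator in the s-part of x and [inr (x, k)] for the k-th one in its
    t-part; [pickle] makes the generators distinct. *)
Definition letter : countType := (var + var * nat)%type.

Definition wd (i : letter) : W2 :=
  match i with
  | inl x => ([::], if vdeg x then [:: pickle i] else [::])
  | inr (x, k) => ([:: pickle i], if vdeg x then [:: pickle i] else [::])
  end.

Definition bw (i : letter) : QA := clsA [:: (1, wd i)].

(* y goes to 1 + sum_k e (x) 1 and z to 1 (x) e + sum_k e (x) e, with pairwise
   distinct generators e of E and k ranging below the multiplicity of the
   variable in u0. *)
Definition phi0 (x : var) : Aelt K :=
  (1, wd (inl x)) :: [seq (1, wd (inr (x, k))) | k <- iota 0 (count_mem x u0)].

Definition spart x : QA := bw (inl x).
Definition tpart x : QA := \sum_(k <- iota 0 (count_mem x u0)) bw (inr (x, k)).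

Lemma clsA_phi0 x : clsA (phi0 x) = spart x + tpart x.
Proof.
rewrite /phi0 clsA_cons; congr (_ + _).
by rewrite clsA_sum big_map.
Qed.

Lemma Ahomog_phi0 x : Ahomog (vdeg x) (phi0 x).
Proof.
have H : all (fun m : K * (seq nat * seq nat) => odd (size m.2.2) == vdeg x) (phi0 x).
  by rewrite /phi0 /= all_map; apply/andP; split; [|apply/allP => k _ /=]; case: ifP.
move=> S T; have [//|/eqP oT] := eqVneq (odd (size T)) (vdeg x).
rewrite /acoef big1_seq ?eqxx // => -[c [u v]] /andP[/andP[_ /eqP vT] /(allP H)/eqP vx].
by case: oT; rewrite -vx -vT size_sort.
Qed.

Lemma color_spart x : color false (vdeg x) (spart x).
Proof.
by exists [:: (1, wd (inl x))]; rewrite //= /wcolor /=; case: ifP.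
Qed.

Lemma color_bw x k : color true (vdeg x) (bw (inr (x, k))).
Proof.
by exists [:: (1, wd (inr (x, k)))]; rewrite //= /wcolor /=; case: ifP.
Qed.

Lemma color_tpart x : color true (vdeg x) (tpart x).
Proof.
rewrite /tpart; apply: (big_ind (color true (vdeg x))).
- exact: color0.
- by move=> p q; apply: colorD.
- by move=> k _; apply: color_bw.
Qed.

Lemma bw_sq0 x k : bw (inr (x, k)) ^+ 2 = 0.
Proof. exact: odd_word_sq0. Qed.

Lemma u0_fact x : ((count_mem x u0)`!%:R : K) != 0.
Proof.
have [xu|xu] := boolP (x \in u0); first by have /andP[] := allP u0_good x xu.
by rewrite (count_memPn xu) oner_neq0.
Qed.

Lemma tpart_pow x :
  tpart x ^+ (count_mem x u0) = ((count_mem x u0)`!%:R : K) *: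
     \prod_(k <- iota 0 (count_mem x u0)) bw (inr (x, k)) /\
  tpart x ^+ (count_mem x u0).+1 = 0.
Proof.
have [x1|x0] := boolP (vdeg x).
  apply: sum_sq0_pow => [k|j k]; first exact: bw_sq0.
  by rewrite (color_comm (color_bw x j) (color_bw x k)) x1 scale1r.
have : (count_mem x u0 <= 1)%N.
  have [xu|xu] := boolP (x \in u0); last by rewrite (count_memPn xu).
  by have /andP[_] := allP u0_good x xu; rewrite (negPf x0).
rewrite /tpart; case: (count_mem x u0) => [|[|]] //= _.
  by rewrite !big_nil expr0 expr1 scale1r.
by rewrite !big_seq1 expr1 scale1r bw_sq0.
Qed.

Definition tprod (u : seq var) := \prod_(x <- u) tpart x.

Lemma tprod_perm u u' : perm_eq u u' -> exists b, tprod u = sg b *: tprod u'.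
Proof.
move: u u'; apply: perm_swap_ind => [u|u v w [b E] [b' E']|s1 a b s2].
- by exists false; rewrite scale1r.
- by exists (b (+) b'); rewrite E E' scalerA ksign_addb.
- exists (true && true (+) vdeg a && vdeg b).
  rewrite /tprod !big_cat !big_cons /= scalerAr; congr (_ * _).
  rewrite mulrA (color_comm (color_tpart a) (color_tpart b)) -scalerAl.
  by rewrite mulrA.
Qed.

Lemma tprod_gt x u : (count_mem x u0 < count_mem x u)%N -> tprod u = 0.
Proof.
move=> h; pose n := (count_mem x u0).+1.
pose r := nseq (count_mem x u - n) x ++ filter (predC (pred1 x)) u.
have ur : perm_eq u (nseq n x ++ r).
  rewrite /r catA -nseqD subnKC // perm_sym.
  have -> : nseq (count_mem x u) x = filter (pred1 x) u.
    by rewrite -size_filter; apply/esym/all_pred1P/filter_all.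
  by rewrite perm_filterC.
have [b ->] := tprod_perm ur; rewrite /tprod big_cat big_nseq iter_mulr_1 /=.
by rewrite (tpart_pow x).2 mul0r scaler0.
Qed.

(** Unless some letter is more frequent in [u] than in [u0], the length forces equal content. *)
Lemma tprod_size u : (size u0 <= size u)%N -> ~~ perm_eq u u0 -> tprod u = 0.
Proof.
move=> su; have [h|/existsNP[x /negP]] := pselect (forall x, count_mem x u <= count_mem x u0)%N; last first.
  by rewrite -ltnNge => /tprod_gt.
have [s ss us] := (count_subseqP u u0).1 h.
have [_] := size_subseq_leqif ss; rewrite -(perm_size us) => E.
have sE : size u == size u0.
  by rewrite eqn_leq su (perm_size us) size_subseq.
by move: us; rewrite sE in E; rewrite -(eqP (esym E)) => ->.
Qed.

Lemma nform_scomm b : ~~ odd (size b.2) ->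
  nform (fun x => spart x + tpart x) b =
  2%:R ^+ (size b.2)./2 *:
    ((\prod_(x <- b.1) (spart x + tpart x)) * tprod b.2).
Proof.
case: b => w u /= ou; rewrite /nform /mon /= scalerAr; congr (_ * _).
move: u ou; fix IH 1; case=> [|a [//|b u]] /=.
  by rewrite /tprod big_nil expr0 scale1r.
rewrite negbK => /IH->; rewrite /scomm.
rewrite (homA_scomm (color_spart a) (color_tpart a) (color_spart b) (color_tpart b)).
by rewrite -scalerAr -scalerAl scalerA -exprSr /tprod !big_cons mulrA.
Qed.

Lemma tpart_mulC x w : exists b,
  tpart x * (\prod_(y <- w) spart y) = sg b *: ((\prod_(y <- w) spart y) * tpart x).
Proof.
elim: w => [|y w [b IH]]; first by exists false; rewrite !big_nil mulr1 mul1r scale1r.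
exists (true && false (+) vdeg x && vdeg y (+) b).
rewrite !big_cons mulrA (color_comm (color_tpart x) (color_spart y)) -scalerAl.
by rewrite -(mulrA (spart y) (tpart x)) IH -scalerAr scalerA -ksign_addb mulrA.
Qed.

(** A short [w] means a long [u], so [tprod_size] applies. When [u] rearranges [u0], one more t
    annihilates [tprod u], and only the s-parts of the letters of [w] remain. *)
Lemma top_prod w u : (size w <= size w0)%N -> perm_eq (w ++ u) (w0 ++ u0) ->
  (\prod_(x <- w) (spart x + tpart x)) * tprod u =
  if perm_eq u u0 then (\prod_(x <- w) spart x) * tprod u else 0.
Proof.
move=> sw wu; have := perm_size wu; rewrite !size_cat => ss.
have su : (size u0 <= size u)%N by rewrite -(leq_add2l (size w0)) -ss leq_add2r.
case: ifPn => [uu|/(tprod_size su)->]; last by rewrite mulr0.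
have tu x : tpart x * tprod u = 0.
  rewrite -[RHS](@tprod_size (x :: u)).
  - by rewrite /tprod big_cons.
  - by rewrite /= (leq_trans su).
  - by apply/negP => /perm_size/eqP; rewrite /= (perm_size uu) eqn_leq ltnn.
elim: w {sw wu ss} => [|x w IH]; first by rewrite !big_nil.
rewrite !big_cons -mulrA IH mulrDl mulrA.
have [b E] := tpart_mulC x w.
by rewrite (mulrA (tpart x)) E -scalerAl -mulrA -mulrA tu mulr0 scaler0 addr0.
Qed.

Definition letters : seq letter :=
  [seq inl x | x <- w0] ++ [seq inr (x, k) | x <- undup u0, k <- iota 0 (count_mem x u0)].

Lemma bw_prod (s : seq letter) : \prod_(i <- s) bw i =
  clsA [:: (1, (flatten [seq (wd i).1 | i <- s], flatten [seq (wd i).2 | i <- s]))].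
Proof.
elim: s => [|i s IH]; first by rewrite big_nil.
by rewrite big_cons IH -clsAM /Amul /= mulr1.
Qed.

(** [g] is one of the components of [wd]. Even variables may repeat in [w0], so their [inl] letters
    must contribute the empty word; this is the condition on [P]. *)
Lemma letters_uniq (P : pred letter) (g : letter -> seq nat) :
  (forall i, g i = if P i then [:: pickle i] else [::]) ->
  (forall x, P (inl x) -> vdeg x) -> uniq (flatten [seq g i | i <- letters]).
Proof.
move=> gP Pin.
have -> : flatten [seq g i | i <- letters] = [seq pickle i | i <- letters & P i].
  elim: letters => //= i s ->; rewrite gP; by case: ifP.
rewrite map_inj_uniq; last exact: (pcan_inj pickleK).
rewrite /letters filter_cat cat_uniq; apply/and3P; split.
- rewrite filter_map map_inj_uniq => [|x x' [] //].
  set s := filter _ w0; apply: count_mem_uniq => x.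
  have [xs|/count_memPn->//] := boolP (x \in s).
  apply/eqP; rewrite eqn_leq -has_count has_pred1 xs andbT.
  apply: leq_trans (leq_count_subseq _ (filter_subseq _ _)) _.
  move: xs; rewrite mem_filter => /andP[/Pin x1 xw].
  exact: (implyP (allP w0_uniq x xw)).
- apply/hasPn => i; rewrite mem_filter => /andP[_ /allpairsPdep[x [k [_ _ ->]]]].
  by apply/negP; rewrite /= mem_filter => /andP[_ /mapP[]].
- apply: filter_uniq; apply: allpairs_uniq_dep; first exact: undup_uniq.
    by move=> x _; apply: iota_uniq.
  by move=> [x k] [x' k'] _ _ /= [-> ->].
Qed.

Lemma gsign_neq0 (s : seq nat) : uniq s -> gsign K s != 0.
Proof. by rewrite /gsign => ->; rewrite signr_eq0. Qed.

Lemma clsA_word_neq0 U V : uniq U -> uniq V -> clsA [:: (1 : K, (U, V))] != 0.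
Proof.
move=> uU uV; apply/eqP => /clsA_eq0/(_ (sort leq U) (sort leq V))/eqP.
rewrite /acoef big_mkcond big_seq1 !eqxx mul1r.
by rewrite mulf_eq0 !(negPf (gsign_neq0 _)).
Qed.

(** Grouping equal letters of [u0] yields the factorials of the multiplicities, nonzero by [good],
    times a word without repetition in either tensor factor. *)
Lemma top_prod_neq0 : (\prod_(x <- w0) spart x) * tprod u0 != 0.
Proof.
have [b ->] : exists b, tprod u0 =
    sg b *: tprod (flatten [seq nseq (count_mem x u0) x | x <- undup u0]).
  by apply: tprod_perm; rewrite perm_sym perm_count_undup.
have -> : tprod (flatten [seq nseq (count_mem x u0) x | x <- undup u0]) =
    (\prod_(x <- undup u0) (count_mem x u0)`!%:R : K) *:
    \prod_(i <- [seq inr (x, k) | x <- undup u0, k <- iota 0 (count_mem x u0)]) bw i.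
  rewrite big_allpairs_dep /= -scaler_prod /tprod big_flatten big_map.
  apply: eq_bigr => x _; rewrite big_nseq iter_mulr_1.
  exact: (tpart_pow x).1.
rewrite -!scalerAr scalerA.
have -> : (\prod_(x <- w0) spart x) = \prod_(i <- [seq inl x | x <- w0]) bw i.
  by rewrite big_map.
rewrite -big_cat -/letters bw_prod scaler_eq0 negb_or; apply/andP; split.
  rewrite mulf_neq0 ?signr_eq0 // prodf_seq_neq0; apply/allP => x _ /=.
  exact: u0_fact.
apply: clsA_word_neq0.
  apply: (letters_uniq (P := fun i => if i is inr _ then true else false)) => //.
  by case=> [x|[x k]].
apply: (letters_uniq (P := fun i => match i with inl x | inr (x, _) => vdeg x end)) => //.
by case=> [x|[x k]].
Qed.

End Independence.

(** * Every graded identity lies in the T_2-ideal *)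

Section Completeness.
Variables (K : fieldType) (G : fpoly K -> Prop).
Hypothesis Kinf : forall s : seq K, exists x : K, x \notin s.
Hypothesis K2 : 2%:R != 0 :> K.
Hypothesis G1 : ~ T2ideal G (pone K).
Hypothesis G_sound : forall f, T2ideal G f -> T2A f.
Hypothesis G_span : forall v, nspan (XG G1) v (mon (XG G1) v).
Local Notation X := (XG G1).

Lemma seq_argmax (T : eqType) (s : seq T) (h : T -> nat) x0 : x0 \in s ->
  exists2 x, x \in s & forall y, y \in s -> (h y <= h x)%N.
Proof.
elim: s x0 => // a [|b s] IH x0 _.
  by exists a => [|y]; rewrite inE // => /eqP->.
have [x xs xmax] := IH b (mem_head _ _).
have [ax|xa] := leqP (h a) (h x).
  by exists x => [|y]; rewrite inE ?xs ?orbT // => /orP[/eqP->|/xmax].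
exists a => [|y]; rewrite inE ?eqxx // => /orP[/eqP->//|/xmax h1].
exact: leq_trans h1 (ltnW xa).
Qed.

Lemma nspan_perm v v' r : perm_eq v v' -> nspan X v r -> nspan X v' r.
Proof.
move=> vv [l lP ->]; exists l => //; apply: sub_all lP => m /andP[-> /=].
by move/perm_trans; apply.
Qed.

Lemma T2A_homog_T2ideal v f : all (fun m => perm_eq m.2 v) f -> T2A f -> T2ideal G f.
Proof.
move=> fv f0; apply/(ev_XG_eq0 G1).
have [l lP fE] : nspan X v (ev X f).
  rewrite /ev /leval; elim: f fv {f0} => [|m f IH] /=.
    by rewrite big_nil => _; apply: nspan0.
  rewrite big_cons => /andP[mv /IH]; apply: nspanD.
  by apply: nspanZ; apply: nspan_perm mv _; apply: G_span.
rewrite fE leval_coef; set L := undup _; set c := lcoef l.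
have LP b : b \in L -> normal K b /\ perm_eq (b.1 ++ b.2) v.
  by rewrite mem_undup => /mapP[m /(allP lP)/andP[mn mp] ->].
have [/allP c0|/allPn[b1 b1L c1]] := boolP (all (fun b => c b == 0) L).
  by rewrite big1_seq // => b /andP[_ /c0/eqP->]; rewrite scale0r.
have b1L' : b1 \in [seq b <- L | c b != 0] by rewrite mem_filter c1.
have [b0 b0L b0max] := seq_argmax (fun b : VP => size b.1) b1L'.
move: b0L; rewrite mem_filter => /andP[c0 /[dup] b0L /LP[b0N b0v]].
case/and5P: b0N => /eqP w0s /eqP u0s u0e u0g w0g.
pose rho x := spart K x + tpart K b0.2 x.
(* [f] and its normal form differ by an element of the ideal, which is an identity by soundness; as
   [f] is one too, the normal form vanishes at [rho]. *)
have h0 : \sum_(b <- L) c b *: nform rho b = 0.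
  pose g := psub f (psum [seq pscale (c b) (fnform K b) | b <- L]).
  have evg (V : algType K) (r : var -> V) :
      ev r g = ev r f - \sum_(b <- L) c b *: nform r b.
    rewrite /g evB ev_sum big_map; congr (_ - _); apply: eq_bigr => b _.
    by rewrite evZ ev_fnform.
  have /G_sound g0 : T2ideal G g.
    by apply/(ev_XG_eq0 G1); rewrite evg fE leval_coef subrr.
  have rhoE : (fun x => clsA (phi0 K b0.2 x)) = rho.
    by apply/funext => x; rewrite clsA_phi0.
  have := g0 _ (@Ahomog_phi0 K b0.2) => /clsA_eq0; rewrite clsA_Aeval rhoE evg.
  have := f0 _ (@Ahomog_phi0 K b0.2) => /clsA_eq0; rewrite clsA_Aeval rhoE => ->.
  by rewrite sub0r => /eqP; rewrite oppr_eq0 => /eqP.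
have b0nz : nform rho b0 != 0.
  rewrite nform_scomm // (top_prod u0g (leqnn _) (perm_refl _)) perm_refl scaler_eq0.
  by rewrite expf_eq0 (negPf K2) andbF /= top_prod_neq0.
suff : c b0 *: nform rho b0 = 0 by move/eqP; rewrite scaler_eq0 (negPf c0) (negPf b0nz).
rewrite -[RHS]h0 (bigD1_seq b0) ?undup_uniq //= big1_seq ?addr0 // => b /andP[bb0 bL].
have [->|cb] := eqVneq (c b) 0; first by rewrite scale0r.
have [/and5P[/eqP ws /eqP us ue _ _] bv] := LP b bL.
rewrite nform_scomm // (@top_prod _ b0.1 b0.2 u0g).
(* Equal content of the second words gives equal content of the first ones, and sorted words of
   equal content coincide: b = b0. *)
- case: ifPn => [uu|_]; last by rewrite !scaler0.
  case/eqP: bb0; case: b b0 {c1 b1L' rho h0 b0nz b0max} ws us uu bv w0s u0s b0v {bL b0L c0 u0e u0g w0g cb ue} => [w u] [w0 u0] /= ws us uu bv w0s u0s b0v.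
  congr pair; first rewrite ws w0s; last rewrite us u0s; apply: vsort_perm => //.
  rewrite -(perm_cat2r u); apply: perm_trans bv _; rewrite perm_sym.
  by apply: perm_trans b0v; rewrite perm_cat2l.
- by apply: b0max; rewrite mem_filter cb.
- by apply: perm_trans bv _; rewrite perm_sym.
Qed.

Lemma T2A_T2ideal f : T2A f -> T2ideal G f.
Proof.
apply: (T2A_homog_ind Kinf).
- exact: T2ideal_nil.
- exact: T2ideal_cat.
- exact: T2ideal_ext.
- exact: T2A_homog_T2ideal.
Qed.

End Completeness.

Lemma T2A_pone (K : fieldType) : ~ T2A (pone K).
Proof.
move=> /(_ (fun=> [::])) h; have /clsA_eq0 : Azero (Aeval (fun=> [::]) (pone K)).
  by apply: h => x S T; rewrite /acoef big_nil eqxx.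
by rewrite clsA_Aeval ev1 => /eqP; rewrite oner_eq0.
Qed.

Theorem mainTheorem10 (K : fieldType) :
  ([pchar K] =i pred0 ->
     forall f : fpoly K, T2A f <-> T2ideal (@genI K) f) /\
  (forall p : nat, p \in [pchar K] -> (2 < p)%N ->
     (forall s : seq K, exists x : K, x \notin s) ->
     forall f : fpoly K, T2A f <-> T2ideal (@genIp K p) f).
Proof.
split=> [K0|p pK p_gt2 Kinf].
  have sound := T2ideal_sub_T2A (@genI_sound K).
  (* Soundness shows that the ideal is proper, so the relatively free algebra is a nonzero ring. *)
  have G1 : ~ T2ideal (@genI K) (pone K) by move/sound/T2A_pone.
  have Kinf (s : seq K) : exists x : K, x \notin s.
    have inj : injective (fun n => n%:R : K).
      move=> m n /eqP; wlog mn : m n / (m <= n)%N => [H|].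
        by case/orP: (leq_total m n) => mn mnE; [|symmetry]; apply: H => //; rewrite eq_sym.
      rewrite eq_sym -subr_eq0 -natrB // pchar0_natr // subn_eq0 => nm.
      by apply/eqP; rewrite eqn_leq mn.
    apply: contrapT => /forallNP sP.
    have := @uniq_leq_size _ [seq n%:R | n <- iota 0 (size s).+1] s.
    rewrite size_map size_iota ltnn => /(_ _ _)/notF; apply.
      by rewrite map_inj_uniq // iota_uniq.
    by move=> x _; apply/negPn/negP/sP.
  move=> f; split; last exact: sound.
  apply: (T2A_T2ideal Kinf _ sound (@nspan_word_pchar0 K K0 G1)).
  by rewrite pchar0_natr.
have sound f : T2ideal (@genIp K p) f -> T2A f.
  by apply: T2ideal_sub_T2A => g; apply: genIp_sound.
have G1 : ~ T2ideal (@genIp K p) (pone K) by move/sound/T2A_pone.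
move=> f; split; last exact: sound.
apply: (T2A_T2ideal Kinf _ sound (@nspan_word_pchar K p pK p_gt2 G1)).
exact: pchar_neq2 pK p_gt2.
Qed.
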